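(* Let $\mathcal{A}=(A_n)$ be a van Hove sequence on $G$, and let $\mu$ be a translation bounded measure on $G$ supported inside a uniformly discrete set $\varLambda\subseteq G$. For $\varepsilon>0$ let $AP_{\mathsf{B},\mathcal{A}}(\mu,\varepsilon)=\{t\in G:\|\mu-\tau_t\mu\|_{\mathsf{B},\mathcal{A}}<\varepsilon\}$. (a) If, for each $\varepsilon>0$, the set $AP_{\mathsf{B},\mathcal{A}}(\mu,\varepsilon)$ is relatively dense, then $\mu$ is mean almost periodic with respect to $\mathcal{A}$. (b) If $\mu$ is mean almost periodic with respect to $\mathcal{A}$ and $\varLambda-\varLambda$ is uniformly discrete, then for all $\varepsilon>0$ the set $AP_{\mathsf{B},\mathcal{A}}(\mu,\varepsilon)$ is relatively dense.
   Context: $G$ is a locally compact (Hausdorff), $\sigma$-compact abelian group with Haar measure $\theta_G$; $|A|=\theta_G(A)$, and $\mathrm{d}t$ denotes integration against $\theta_G$. A measure on $G$ is a (complex) Radon measure; $|\mu|$ is its total variation. $\mu$ is translation bounded if $\sup_{t\in G}|\mu|(t+V)<\infty$ for one (equivalently every) nonempty open relatively compact $V$. $(\tau_tf)(s)=f(s-t)$ for functions, $\tau_t\mu=\delta_t*\mu$ for measures, and $(\mu*\varphi)(t)=\int_G\varphi(t-s)\,\mathrm{d}\mu(s)$ for $\varphi\in C_c(G)$. A set $P\subseteq G$ is relatively dense if $P+K=G$ for some compact $K$. A set $\varLambda$ is uniformly discrete if there is an open neighbourhood $V$ of $0$ with $(s+V)\cap(t+V)=\varnothing$ for all distinct $s,t\in\varLambda$.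 A van Hove sequence $\mathcal{A}=(A_n)$ is a sequence of relatively compact open sets (of positive measure) with $|\partial^K A_n|/|A_n|\to 0$ for every compact $K\subseteq G$, where $\partial^K A=\big(\overline{A+K}\cap\overline{A^c}\big)\cup\big(\overline{A^c-K}\cap\overline{A}\big)$. For a measure $\nu$, $\|\nu\|_{\mathsf{B},\mathcal{A}}=\limsup_{n}\frac{|\nu|(A_n)}{|A_n|}$; for locally integrable $f$, $\|f\|_{\mathsf{B},1,\mathcal{A}}=\limsup_{n}\frac{1}{|A_n|}\int_{A_n}|f(t)|\,\mathrm{d}t$. A translation bounded measure $\mu$ is mean almost periodic with respect to $\mathcal{A}$ if for every $\varphi\in C_c(G)$ and every $\varepsilon>0$ the set $\{t\in G:\|\mu*\varphi-\tau_t(\mu*\varphi)\|_{\mathsf{B},1,\mathcal{A}}<\varepsilon\}$ is relatively dense. *)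

(* Defs.v *)
From HB Require Import structures.
From mathcomp Require Import all_boot all_order all_algebra.
From mathcomp Require Import complex.
From mathcomp Require Import all_classical all_reals all_analysis.

Set Implicit Arguments.
Unset Strict Implicit.
Unset Printing Implicit Defensive.

Import Order.TTheory GRing.Theory Num.Theory.
Import numFieldNormedType.Exports.
Import ComplexField.Normc.

Local Open Scope classical_set_scope.
Local Open Scope ring_scope.

(* R[i] gets the topology of its norm, which Num.norm takes as an element of
   R[i]; normc is the same modulus as an element of R. *)
HB.instance Definition _ (R : rcfType) := NormedModule.copy R[i] (R[i])^o.

(* A measurableType has to be pointed, which a topologicalZmodType is not. *)
Definition pointed_group (G : topologicalZmodType) : Type := G.

HB.instance Definition _ (G : topologicalZmodType) :=
  Choice.copy (pointed_group G) G.
HB.instance Definition _ (G : topologicalZmodType) :=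
  isPointed.Build (pointed_group G) 0.

Definition borel (G : topologicalZmodType) :=
  g_sigma_algebraType (@open G : set (set (pointed_group G))).

Section Sets.
Variable G : topologicalZmodType.
Implicit Types (A B K P V L : set G) (t : G).

Definition set_add A B : set G := [set x + y | x in A & y in B].

Definition set_sub A B : set G := [set x - y | x in A & y in B].

Definition set_translate t A : set G := [set t + x | x in A].

Definition sigma_compact : Prop :=
  exists K : (set G)^nat, (forall n, compact (K n)) /\ \bigcup_n K n = setT.

Definition relatively_dense P : Prop :=
  exists K, compact K /\ set_add P K = setT.

Definition uniformly_discrete L : Prop :=
  exists V, open_nbhs 0 V /\
    forall s t, L s -> L t -> s <> t ->
      set_translate s V `&` set_translate t V = set0.

Definition van_hove_boundary K A : set G :=
  (closure (set_add A K) `&` closure (~` A)) `|`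
  (closure (set_sub (~` A) K) `&` closure A).

End Sets.

Section Haar.
Variables (R : realType) (G : topologicalZmodType).
Implicit Type theta : {measure set (borel G) -> \bar R}.
Local Open Scope ereal_scope.

(* A nonzero translation invariant Radon measure. *)
Record haar_measure theta : Prop := HaarMeasure {
  haar_invariant : forall t (B : set (borel G)), measurable B ->
    theta (set_translate t B) = theta B;
  haar_compact : forall K : set G, compact K -> theta K < +oo;
  haar_outer_regular : forall B : set (borel G), measurable B ->
    theta B = ereal_inf
      [set theta U | U in [set U : set G | open U /\ B `<=` U]];
  haar_inner_regular : forall U : set G, open U ->
    theta U = ereal_sup
      [set theta K | K in [set K : set G | compact K /\ K `<=` U]];
  haar_neq0 : theta setT != 0 }.

Record van_hove theta (A : (set G)^nat) : Prop := VanHove {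
  van_hove_open : forall n, open (A n);
  van_hove_precompact : forall n, precompact (A n);
  van_hove_gt0 : forall n, 0 < theta (A n);
  van_hove_cvg : forall K : set G, compact K ->
    (fun n => theta (van_hove_boundary K (A n)) / theta (A n)) @ \oo --> 0 }.

End Haar.

Section Cc.
Variables (R : realType) (G : topologicalZmodType).

Definition fsupp (f : G -> R[i]) : set G := closure [set x | f x != 0].

Definition Cc_pred : {pred G -> R[i]} :=
  fun f => `[< continuous f /\ compact (fsupp f) >].

Lemma Cc_predP f : reflect (continuous f /\ compact (fsupp f)) (f \in Cc_pred).
Proof. exact: asboolP. Qed.

Lemma Cc_submod_closed : submod_closed Cc_pred.
Proof.
split=> [|a f g /Cc_predP[cf kf] /Cc_predP[cg kg]]; apply/Cc_predP.
  split; first by move=> x; exact: cvg_cst.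
  rewrite /fsupp (_ : [set _ | _] = set0) ?closure0; first exact: compact0.
  by apply/seteqP; split=> x //=; rewrite eqxx.
split.
  move=> x; apply: cvgD; last exact: cg.
  by apply: cvgZr; exact: cf.
apply: (subclosed_compact _ (compactU kf kg)); first exact: closed_closure.
rewrite /fsupp -closureU; apply: closure_subset => x /=.
have [fx0|fx0] := eqVneq (f x) 0; last by left.
have [gx0|gx0] := eqVneq (g x) 0; last by right.
by rewrite /GRing.add /GRing.scale /= fx0 gx0 scaler0 addr0 eqxx.
Qed.

HB.instance Definition _ :=
  GRing.isSubmodClosed.Build R[i] (G -> R[i]) Cc_pred Cc_submod_closed.

(* C_c(G), complex-valued. *)
Record Cc := MkCc { Cc_fun :> G -> R[i]; _ : Cc_fun \in Cc_pred }.

HB.instance Definition _ := [isSub for Cc_fun].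
HB.instance Definition _ := [Choice of Cc by <:].
HB.instance Definition _ := [SubChoice_isSubLmodule of Cc by <:].

Lemma Cc_comp (h k : G -> G) : continuous h -> continuous k ->
  cancel h k -> cancel k h -> forall f : Cc, (f \o h : G -> R[i]) \in Cc_pred.
Proof.
move=> ch ck hk kh [f /= /Cc_predP[cf kf]]; apply/Cc_predP; split.
  by move=> x; apply: continuous_comp; [exact: ch|exact: cf].
have -> : fsupp (f \o h) = k @` fsupp f; last first.
  by apply: continuous_compact => //; exact: continuous_subspaceT.
apply/seteqP; split=> [x xs|_ [y ys <-]].
  exists (h x) => // B Bhx; have [z [/= fz Bz]] := xs _ (ch x _ Bhx).
  by exists (h z).
move=> B Bky; have [z [/= fz Bz]] := ys _ (ck y _ Bky).
by exists (k z); split => //=; rewrite kh.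
Qed.

Lemma addl_continuous (t : G) : continuous (fun s : G => t + s).
Proof.
move=> x; apply: (@continuous_comp _ _ _ (fun s : G => (t, s))
  (fun x : G * G => x.1 + x.2)); last exact: add_continuous.
by apply: cvg_pair => /=; [exact: cvg_cst|exact: cvg_id].
Qed.

Lemma subl_continuous (t : G) : continuous (fun s : G => t - s).
Proof.
move=> x; apply: (@continuous_comp _ _ _ (fun s : G => - s)
  (fun s : G => t + s)); [exact: opp_continuous|exact: addl_continuous].
Qed.

Lemma Cc_translate_subproof (t : G) (f : Cc) : (fun s => f (t + s)) \in Cc_pred.
Proof.
exact: (Cc_comp (@addl_continuous t) (@addl_continuous (- t))
  (addKr t) (addNKr t) f).
Qed.

Lemma Cc_reflect_subproof (t : G) (f : Cc) : (fun s => f (t - s)) \in Cc_pred.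
Proof.
have tK : cancel (fun s : G => t - s) (fun s => t - s) by move=> s; rewrite subKr.
exact: (Cc_comp (@subl_continuous t) (@subl_continuous t) tK tK f).
Qed.

Definition Cc_translate (t : G) (f : Cc) : Cc :=
  MkCc (Cc_translate_subproof t f).

Definition Cc_reflect (t : G) (f : Cc) : Cc := MkCc (Cc_reflect_subproof t f).

End Cc.

Arguments Cc : clear implicits.

Section Radon.
Variables (R : realType) (G : topologicalZmodType).

(* Radon measures as linear functionals on C_c(G), continuous for the inductive
   limit topology; mu phi is the integral of phi against mu. *)
Record radon_measure := RadonMeasure {
  radon_linear :> {linear Cc R G -> R[i]};
  radon_bounded : forall K : set G, compact K ->
    exists a : R, forall phi : Cc R G, fsupp phi `<=` K ->
      normc (radon_linear phi) <= a * sup [set normc (phi x) | x in [set: G]] }.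

(* The operations below only use the underlying functional, so that they also
   apply to differences of Radon measures. *)
Implicit Type mu : Cc R G -> R[i].

Definition measure_supp mu : set G :=
  [set x | forall U : set G, open_nbhs x U ->
    exists phi : Cc R G, fsupp phi `<=` U /\ mu phi <> 0].

(* The total variation |mu|: first as a functional on the nonnegative elements
   of C_c(G), then on open sets, and then on all sets by outer regularity.
   The inequalities between values of phi and psi are in R[i], where a <= b
   means that b - a is a nonnegative real. *)
Definition variation_Cc mu (phi : Cc R G) : \bar R :=
  ereal_sup [set (normc (mu psi))%:E |
    psi in [set psi : Cc R G | forall x, `|psi x| <= phi x]].

Definition variation_open mu (U : set G) : \bar R :=
  ereal_sup [set variation_Cc mu phi |
    phi in [set phi : Cc R G | forall x, 0 <= phi x <= \1_U x]].

Definition variation mu (B : set G) : \bar R :=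
  ereal_inf [set variation_open mu U |
    U in [set U : set G | open U /\ B `<=` U]].

Definition translation_bounded mu : Prop :=
  exists V : set G, [/\ open V, V !=set0, precompact V &
    (ereal_sup [set variation mu (set_translate t V) | t in [set: G]]
       < +oo)%E].

Definition translate_fun (t : G) (f : G -> R[i]) : G -> R[i] :=
  fun s => f (s - t).

(* delta_t * mu, that is, phi |-> \int phi (t + s) dmu(s). *)
Definition translate_measure (t : G) mu : Cc R G -> R[i] :=
  fun phi => mu (Cc_translate t phi).

(* t |-> \int phi (t - s) dmu(s) *)
Definition convolution mu (phi : Cc R G) : G -> R[i] :=
  fun t => mu (Cc_reflect t phi).

Variables (theta : {measure set (borel G) -> \bar R}) (A : (set G)^nat).

Definition besicovitch_measure mu : \bar R :=
  limn_esup (fun n => variation mu (A n) / theta (A n))%E.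

Definition besicovitch_fun (f : G -> R[i]) : \bar R :=
  limn_esup (fun n =>
    (\int[theta]_(t in A n) (normc (f t))%:E) / theta (A n))%E.

Definition mean_almost_periodic mu : Prop :=
  forall (phi : Cc R G) (eps : R), 0 < eps ->
    relatively_dense [set t : G |
      (besicovitch_fun
         (convolution mu phi \- translate_fun t (convolution mu phi))%R
       < eps%:E)%E].

Definition almost_periods mu (eps : R) : set G :=
  [set t : G |
    (besicovitch_measure (mu \- translate_measure t mu)%R < eps%:E)%E].

End Radon.

Arguments radon_measure : clear implicits.

(* Main.v *)
(** A Radon measure supported in a uniformly discrete set is a locally finite sum
    [mu = \sum_s c s * delta_s], so that [mu - tau_t mu] has the coefficients
    [d s = c s - c (s - t)], and its total variation on an open set is the sum of
    the [|d s|] over that set. By translation boundedness, the coefficients in a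
    neighbourhood [(A_n + K) `&` (~A_n - K)] of the boundary of [A_n] contribute
    only [o(|A_n|)].

    (a) [mu * phi - tau_t (mu * phi) = \sum_s d s * phi (x - s)], whose integral
    over [A_n] is at most a constant times [\sum_(s in A_n) |d s| + o(|A_n|)].

    (b) Take for [phi] a bump with small support [Q], and let [t] be an almost
    period of [mu * phi]. As [Lambda - Lambda] is uniformly discrete, all pairs
    [s, s'] in the support of [c] with [s - s' - t] in [Q - Q] have the same
    offset [s - s' - t = v]. The functions
    [c u * phi (x - u) - c (u - (t + v)) * phi (x - u + v)] then have disjoint
    supports and sum to [mu * phi - tau_t (mu * phi)], and the integral of the
    modulus of each is at least [|c u - c (u - (t + v))|] times the integral of
    [phi]. Hence [t + v] is an almost period of [mu], where [v] stays in the
    compact set [Q - Q]. *)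

From HB Require Import structures.
Require Import Defs.
From mathcomp Require Import all_boot all_order all_algebra.
From mathcomp Require Import complex.
From mathcomp Require Import all_classical all_reals all_analysis.
From mathcomp Require Import ring lra.
From mathcomp Require Import measurable_realfun.

Set Implicit Arguments.
Unset Strict Implicit.
Unset Printing Implicit Defensive.

Import Order.TTheory GRing.Theory Num.Theory.
Import numFieldNormedType.Exports.
Import ComplexField.Normc.

Local Open Scope classical_set_scope.
Local Open Scope ring_scope.
Local Open Scope complex_scope.

(** Makes sums over atoms independent of the enumerating list: both sides reduce to their nonzero
    terms, which the two lists share up to a permutation. *)
Lemma eq_big_uniq (V : nmodType) (I : eqType) (f : I -> V) (s1 s2 : seq I) :
  uniq s1 -> uniq s2 -> (forall i, f i != 0 -> (i \in s1) = (i \in s2)) ->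
  \sum_(i <- s1) f i = \sum_(i <- s2) f i.
Proof.
move=> u1 u2 s12.
have nz s : \sum_(i <- s) f i = \sum_(i <- s | f i != 0) f i.
  rewrite [RHS]big_mkcond; apply: eq_bigr => i _.
  by case: eqVneq.
rewrite nz [RHS]nz -[LHS]big_filter -[RHS]big_filter; apply: perm_big.
apply: uniq_perm; rewrite ?filter_uniq// => i; rewrite !mem_filter.
by case: eqVneq => //= /s12 ->.
Qed.

(** * Modulus and phase of complex numbers *)

Section complex_modulus.
Variable R : realType.
Implicit Types z w : R[i].

Lemma normrC z : `|z| = (normc z)%:C.
Proof. by []. Qed.

Lemma normc_ge0 z : 0 <= normc z.
Proof. by case: z => a b /=; exact: sqrtr_ge0. Qed.

Lemma normcB z w : normc (z - w) = normc (w - z).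
Proof. by rewrite -opprB normcN. Qed.

Lemma normcR (r : R) : normc r%:C = `|r|.
Proof. by rewrite /= expr0n addr0 sqrtr_sqr. Qed.

Lemma normc_triangle z w : normc (z + w) <= normc z + normc w.
Proof. exact: le_normcD. Qed.

Lemma normc_sum (I : Type) (s : seq I) (f : I -> R[i]) :
  normc (\sum_(i <- s) f i) <= \sum_(i <- s) normc (f i).
Proof.
elim/big_rec2: _ => [|i y1 y2 _ le12]; first by rewrite normc0.
by rewrite (le_trans (normc_triangle _ _))// lerD2l.
Qed.

Lemma ler_normc_dist z w : `|normc z - normc w| <= normc (z - w).
Proof.
have H (u v : R[i]) : normc u - normc v <= normc (u - v).
  by rewrite lerBlDr; have := normc_triangle (u - v) v; rewrite subrK.
by rewrite ler_norml lerNl opprB {1}normcB !H.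
Qed.

Lemma ler_Re_normc z : complex.Re z <= normc z.
Proof.
case: z => a b /=; rewrite (le_trans (ler_norm a))// -sqrtr_sqr.
by rewrite ler_wsqrtr// lerDl sqr_ge0.
Qed.

(** The witness is the conjugate of [z] divided by its modulus. For [z = 0] the convention
    [0^-1 = 0] makes it [0], hence an inequality for [normc w]. *)
Lemma normc_phase z : exists w, normc w <= 1 /\ z * w = (normc z)%:C.
Proof.
exists ((normc z)^-1%:C * z^*%C); split.
  rewrite normcM normcR.
  have -> : normc z^*%C = normc z by case: z => a b /=; rewrite sqrrN.
  have [->|z0] := eqVneq (normc z) 0; first by rewrite mulr0.
  by rewrite ger0_norm ?invr_ge0 ?normc_ge0// mulVf.
rewrite mulrCA -sqr_normc normrC -rmorphXn -rmorphM/= expr2.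
have [->|z0] := eqVneq (normc z) 0; first by rewrite !mulr0.
by rewrite mulKf.
Qed.

Lemma continuous_normc (T : topologicalType) (f : T -> R[i]) :
  continuous f -> continuous (fun x => normc (f x)).
Proof.
move=> cf x; apply/cvgrPdist_lt => e e0.
have e0' : 0 < e%:C by rewrite ltcR.
move: (cf x) => /cvgrPdist_lt /(_ _ e0'); apply: filterS => y.
by rewrite normrC ltcR => /(le_lt_trans (ler_normc_dist _ _)).
Qed.

Lemma continuous_complexR (T : topologicalType) (f : T -> R) :
  continuous f -> continuous (fun x => (f x)%:C).
Proof.
move=> cf x; apply/cvgrPdist_lt => e; case: e => e e'.
rewrite ltcE /= => /andP[/eqP e'0 e0].
move: (cf x) => /cvgrPdist_lt /(_ _ e0); apply: filterS => y.
by rewrite -rmorphB normrC normcR /= e'0 ltcR.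
Qed.

End complex_modulus.

(** * Topological groups *)

Section topological_group.
Variable G : topologicalZmodType.
Implicit Types (A B K U V : set G) (x t : G).

Lemma addr_continuous t : continuous (fun s : G => s + t).
Proof.
have -> : (fun s : G => s + t) = (fun s => t + s).
  by apply/funext => s; rewrite addrC.
exact: addl_continuous.
Qed.

Lemma subr_continuous t : continuous (fun s : G => s - t).
Proof. exact: addr_continuous. Qed.

Lemma set_translateE t A : set_translate t A = (fun s => s - t) @^-1` A.
Proof.
apply/seteqP; split=> [_ [x Ax <-]|x Ax] /=; first by rewrite addrC addKr.
by exists (x - t) => //; rewrite addrC subrK.
Qed.

Lemma open_set_translate t A : open A -> open (set_translate t A).
Proof.
rewrite set_translateE => oA.
by apply: open_comp => // x _; exact: subr_continuous.
Qed.

Lemma compact_image (f : G -> G) K : continuous f -> compact K -> compact (f @` K).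
Proof.
by move=> cf; apply: continuous_compact; exact: continuous_subspaceT.
Qed.

Lemma compact_add K1 K2 : compact K1 -> compact K2 -> compact (set_add K1 K2).
Proof.
move=> c1 c2.
have -> : set_add K1 K2 = (fun x : G * G => x.1 + x.2) @` (K1 `*` K2).
  apply/seteqP; split=> [_ [x Kx [y Ky <-]]|_ [[x y] [/= Kx Ky] <-]].
    by exists (x, y).
  by exists x => //; exists y.
apply: continuous_compact; last exact: compact_setX.
by apply: continuous_subspaceT => x; exact: add_continuous.
Qed.

Lemma compact_opp K : compact K -> compact (-%R @` K).
Proof. by apply: compact_image => x; exact: opp_continuous. Qed.

Lemma compact_sub K1 K2 : compact K1 -> compact K2 -> compact (set_sub K1 K2).
Proof.
move=> c1 c2.
have -> : set_sub K1 K2 = set_add K1 (-%R @` K2).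
  apply/seteqP; split=> [_ [x Kx [y Ky <-]]|_ [x Kx [_ [y Ky <-] <-]]].
    by exists x => //; exists (- y) => //; exists y.
  by exists x => //; exists y.
by apply: compact_add => //; exact: compact_opp.
Qed.

Lemma open_set_opp A : open A -> open (-%R @` A).
Proof.
have -> : -%R @` A = -%R @^-1` A.
  apply/seteqP; split=> [_ [x Ax <-]|x Ax] /=; first by rewrite opprK.
  by exists (- x) => //; rewrite opprK.
by move=> oA; apply: open_comp => // x _; exact: opp_continuous.
Qed.

Lemma nbhs0_sub V : nbhs 0 V ->
  exists W, open_nbhs 0 W /\ forall x y, W x -> W y -> V (x - y).
Proof.
move=> V0.
have c : (fun x : G * G => x.1 - x.2) @ nbhs ((0 : G), (0 : G)) --> ((0 : G) - 0).
  apply: (@cvg_comp _ _ _ (fun x : G * G => (x.1, - x.2))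
    (fun x : G * G => x.1 + x.2) _ (nbhs ((0 : G), - (0 : G)))); last first.
    exact: (@add_continuous G ((0 : G), - (0 : G))).
  apply: cvg_pair => /=; first exact: cvg_fst.
  by apply: (@cvg_comp _ _ _ snd -%R); [exact: cvg_snd|exact: opp_continuous].
rewrite subr0 in c.
have [[A B] /= [A0 B0] AB] := c _ V0.
exists (interior A `&` interior B); split.
  split; first by apply: openI; exact: open_interior.
  by split; exact: nbhs_singleton (nbhs_interior _).
move=> x y [/interior_subset Ax _] [_ /interior_subset By].
exact: (AB (x, y)).
Qed.

Lemma uniformly_discrete_sep L : uniformly_discrete L ->
  exists V, open_nbhs 0 V /\ forall s t, L s -> L t -> V (s - t) -> s = t.
Proof.
move=> [V [[oV V0] VL]]; exists V; split=> // s t Ls Lt Vst.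
apply: contrapT => /(VL _ _ Ls Lt); apply/eqP/set0P; exists s; split.
  by exists 0; rewrite ?addr0.
by exists (s - t) => //; rewrite addrC subrK.
Qed.

End topological_group.

(* [compact_cover] is stated for pointed spaces. *)
HB.instance Definition _ (G : topologicalZmodType) :=
  Topological.copy (pointed_group G) G.

(** * Finite covers of compact sets *)

Section compact_cover.
Variable G : topologicalZmodType.
Implicit Types (K : set G).

Lemma compact_open_cover K (U : G -> set G) : compact K ->
  (forall x, K x -> open_nbhs x (U x)) ->
  exists s : seq G, {in s, forall x, K x} /\
    forall y, K y -> exists2 x, x \in s & U x y.
Proof.
move=> cK HU.
have := @compact_cover (pointed_group G) => /(congr1 (fun P => P K)).
move=> /esym => cover; move: cK; rewrite -[compact K]/(@compact (pointed_group G) K).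
rewrite -cover => /(_ G K U) [||s sK Ks].
- by move=> x /HU[].
- by move=> x Kx; exists x => //; case: (HU _ Kx).
exists (finmap.enum_fset s); split=> [x xs|y /Ks [x xs Uxy]]; last by exists x.
by have := sK _ xs; rewrite inE.
Qed.

(** Finitely many translates of [W] cover [K], and each contains at most one point of [L] because
    [W - W] lies in the separating neighbourhood [V]. *)
Lemma uniformly_discrete_finite L K : uniformly_discrete L -> compact K ->
  finite_set (L `&` K).
Proof.
move=> /uniformly_discrete_sep [V [V0 VL]] cK.
have [W [[oW W0] WV]] := nbhs0_sub (open_nbhs_nbhs V0).
have [s [_ sK]] := compact_open_cover cK (U := fun x => set_translate x W)
  (fun x _ => conj (open_set_translate x oW) (ex_intro2 _ _ 0 W0 (addr0 x))).
apply: (@sub_finite_set _ _ (\bigcup_(x in [set` s]) (L `&` set_translate x W))).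
  move=> y [Ly /sK[x xs xy]]; exists x => //; split=> //.
apply: bigcup_finite => [|x _]; first exact: finite_seq.
have [->|/set0P[y [Ly [w Ww xw]]]] := eqVneq (L `&` set_translate x W) set0.
  exact: finite_set0.
apply: (@sub_finite_set _ _ [set y]); last exact: finite_set1.
move=> z [Lz [w' Ww' xw']]; apply: VL => //.
by rewrite -xw -xw' opprD addrACA subrr add0r; exact: WV.
Qed.

End compact_cover.

(** * Bump functions *)

Section bump.
Variables (R : realType) (G : topologicalZmodType).
Hypotheses (G_hausdorff : hausdorff_space G)
  (G_locally_compact : locally_compact [set: G]).

Lemma nbhs_precompact (x : G) : exists U, open_nbhs x U /\ precompact U.
Proof.
have [K xK' [cK clK]] := G_locally_compact (I : [set: G] x).
have xK : nbhs x K by move: xK'; rewrite /within /=; apply: filterS => y; exact.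
exists (interior K); split.
  by split; [exact: open_interior|exact: nbhs_singleton (nbhs_interior _)].
by exists K => //; exact: interior_subset.
Qed.

Lemma continuous_clip (f : G -> R) : continuous f ->
  continuous (fun x => Num.min 1 (Num.max 0 (f x))).
Proof.
move=> cf y; apply: (@continuous_min R G (cst 1) (fun x => Num.max 0 (f x))).
  exact: cvg_cst.
by apply: (@continuous_max R G (cst 0) f); [exact: cvg_cst|exact: cf].
Qed.

(** Complete regularity gives [f] with [f x = 0] and [f = 1] off a precompact part of [U]. Clipping
    [2 - 3 * f] to the unit interval leaves a margin on both sides: the result is [1] where
    [f <= 1/3], hence near [x], and its closed support lies in [f <= 2/3]. *)
Lemma bump (x : G) (U : set G) : open_nbhs x U ->
  exists r : G -> R, [/\ continuous r, (forall y, 0 <= r y <= 1),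
    closure [set y | r y != 0] `<=` U,
    compact (closure [set y | r y != 0]) & \forall y \near x, r y = 1].
Proof.
move=> [oU Ux]; have [W [[oW Wx] cW]] := nbhs_precompact x.
have := @locally_compact_completely_regular _ R G_locally_compact G_hausdorff
   x (~` (U `&` W)) (open_closedC (openI oU oW)) (fun H => H (conj Ux Wx)).
move=> /(@uniform_separatorP _ R)[f [cf f01 fx fUW]].
pose r y := Num.min 1 (Num.max 0 (2 - 3 * f y)).
have cr : continuous r.
  apply: continuous_clip => y.
  by apply: cvgB; [exact: cvg_cst|apply: (@cvgM R); [exact: cvg_cst|exact: cf]].
have cl : closed [set y | f y <= 2 / 3].
  apply: (@preimage_closed _ _ f [set z | z <= 2 / 3]) => [y _|]; first exact: cf.
  exact: closed_le.
have rs : closure [set y | r y != 0] `<=` [set y | f y <= 2 / 3].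
  rewrite (closure_id [set y | f y <= 2 / 3]).1//; apply: closureS => y /=.
  apply: contraNT; rewrite -ltNge => fy; rewrite /r max_l; last by lra.
  by rewrite min_r.
have fU : [set y | f y <= 2 / 3] `<=` U `&` W.
  move=> y /= fy; apply: contrapT => yU.
  have /= fy1 : f y = 1 by apply: fUW; exists y.
  by move: fy; rewrite fy1; lra.
exists r; split=> //.
- by move=> y; rewrite /r le_min ler01 le_max lexx ge_min lexx.
- by move=> y /rs/fU[].
- have [K WK [cK clK]] := cW.
  apply: (subclosed_compact _ cK); first exact: closed_closure.
  by move=> y /rs/fU[_ /WK].
have fx0 : f x = 0 by apply: fx; exists x.
have : f x < 1 / 3 by rewrite fx0; lra.
move: (cf x) => /cvgr_lt /[apply]; apply: filterS => y fy.
by rewrite /r max_r ?min_l//; lra.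
Qed.

End bump.

(** * Radon measures with uniformly discrete support *)

Section radon_vanishing.
Variables (R : realType) (G : topologicalZmodType).
Hypotheses (G_hausdorff : hausdorff_space G)
  (G_locally_compact : locally_compact [set: G]).
Implicit Types (phi psi : Cc R G) (mu : radon_measure R G).

Lemma Cc_continuous phi : continuous phi.
Proof. by case: phi => f /= /Cc_predP[]. Qed.

Lemma Cc_compact phi : compact (fsupp phi).
Proof. by case: phi => f /= /Cc_predP[]. Qed.

Lemma fsupp_neq0 (f : G -> R[i]) x : f x != 0 -> fsupp f x.
Proof. by move=> fx; exact: subset_closure. Qed.

Lemma Cc_cutoff (r : G -> R) phi : continuous r ->
  exists psi, (forall y, psi y = (r y)%:C * phi y) /\
    fsupp psi `<=` closure [set y | r y != 0] `&` fsupp phi.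
Proof.
move=> cr; pose f y := (r y)%:C * phi y.
have fs : fsupp f `<=` closure [set y | r y != 0] `&` fsupp phi.
  rewrite subsetI; split; apply: closureS => y /=; apply: contraNN => /eqP.
    by rewrite /f => ->; rewrite mul0r.
  by rewrite /f => ->; rewrite mulr0.
suff fCc : f \in @Cc_pred R G by exists (MkCc fCc).
apply/Cc_predP; split.
  move=> y; apply: (@cvgM R[i]); last exact: Cc_continuous.
  exact: continuous_complexR.
apply: (subclosed_compact _ (@Cc_compact phi)); first exact: closed_closure.
by move=> y /fs[].
Qed.

Lemma Cc_real (r : G -> R) : continuous r ->
  compact (closure [set y | r y != 0]) ->
  exists psi : Cc R G, forall y, psi y = (r y)%:C.
Proof.
move=> cr kr; suff fCc : (fun y => (r y)%:C) \in @Cc_pred R G by exists (MkCc fCc).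
apply/Cc_predP; split; first exact: continuous_complexR.
rewrite /fsupp (_ : [set x | _] = [set y | r y != 0])//.
by apply/seteqP; split=> y /=; rewrite (inj_eq (@complexI R)).
Qed.

Lemma CcDE phi psi x : (phi + psi) x = phi x + psi x.
Proof. by []. Qed.

Lemma CcBE phi psi x : (phi - psi) x = phi x - psi x.
Proof. by []. Qed.

Lemma CcZE a phi x : (a *: phi) x = a * phi x.
Proof. by []. Qed.

Lemma Cc_sumE (I : Type) (s : seq I) (f : I -> Cc R G) x :
  (\sum_(i <- s) f i) x = \sum_(i <- s) f i x.
Proof.
by elim: s => [|i s ih]; rewrite ?big_nil// !big_cons CcDE ih.
Qed.

Lemma CcP phi psi : phi =1 psi -> phi = psi.
Proof. by move=> h; apply: val_inj; apply/funext. Qed.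

(** Trades the supremum in [radon_bounded] for any uniform bound [e]. The constant there may be
    negative, so its absolute value is used. *)
Lemma radon_le mu (K : set G) : compact K ->
  exists2 a : R, 0 <= a & forall phi (e : R), fsupp phi `<=` K ->
    (forall x, normc (phi x) <= e) -> normc (mu phi) <= a * e.
Proof.
move=> /(radon_bounded mu)[a aP]; exists `|a| => // phi e phiK phie.
apply: (le_trans (aP _ phiK)).
set S := [set _ | _ in _].
have S0 : S !=set0 by exists (normc (phi 0)), 0.
have Se : ubound S e by move=> _ [x _ <-].
have supS : 0 <= sup S.
  apply: (le_trans (normc_ge0 (phi 0))); apply: ub_le_sup; first by exists e.
  by exists 0.
rewrite (le_trans (ler_wpM2r supS (ler_norm a)))//.
by apply: ler_wpM2l => //; exact: ge_sup.
Qed.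

(* A partition of unity without division: phi is peeled off one bump at a time,
   phi = r phi + (1 - r) phi. *)
Lemma radon_eq0_off_supp mu phi :
  (forall x, fsupp phi x -> ~ measure_supp mu x) -> mu phi = 0.
Proof.
move=> phis.
(* [p.1] is a bump whose closed support carries only functions annihilated by [mu], and [p.2] is a
   neighbourhood of [x] on which the bump equals [1]. *)
pose good x (p : (G -> R) * set G) := [/\ continuous p.1, open_nbhs x p.2,
  forall y, p.2 y -> p.1 y = 1 &
  forall psi, fsupp psi `<=` closure [set y | p.1 y != 0] -> mu psi = 0].
have /choice[p pP] : forall x, exists p, fsupp phi x -> good x p.
  move=> x; have [phix|?] := pselect (fsupp phi x); last by exists (cst 0, set0).
  have /existsNP[U /not_implyP[xU /forallNP nU]] := phis _ phix.
  have [r [cr r01 rU _]] := bump R G_hausdorff G_locally_compact xU.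
  rewrite /prop_near1 nbhsE => -[N [oN Nx] Nr].
  exists (r, N) => _; split=> // psi /= psir.
  apply: contrapT => mupsi; apply: (nU psi); split=> //.
  exact: subset_trans rU.
have [s [sphi phi_s]] := compact_open_cover (@Cc_compact phi)
  (U := fun x => (p x).2) (fun x h => let: And4 _ N _ _ := pP x h in N).
have {sphi} sP : {in s, forall x, good x (p x)} by move=> x /sphi/pP.
(* Induction on the list of bumps, for all [phi] whose support is covered by the remaining
   neighbourhoods. Multiplying by [1 - r] removes [(p x).2] from the support, so the tail of the
   list still covers it. *)
move: phi {phis pP} phi_s; elim: s sP => [_ phi phi0|x s ih sP phi phis].
  rewrite (_ : phi = 0) ?raddf0//; apply: CcP => y; apply/eqP/negP => /negP.
  by move=> /fsupp_neq0/phi0[].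
have [cr [oN Nx] Nr rmu] := sP x (mem_head _ _).
have [psi1 [psi1E psi1s]] := @Cc_cutoff (p x).1 phi cr.
have cr' : continuous (fun y => 1 - (p x).1 y).
  by move=> y; apply: cvgB; [exact: cvg_cst|exact: cr].
have [psi2 [psi2E psi2s]] := @Cc_cutoff _ phi cr'.
have -> : phi = psi1 + psi2.
  apply: CcP => y; rewrite CcDE psi1E psi2E -mulrDl -rmorphD/=.
  by rewrite addrC subrK mul1r.
rewrite raddfD/= rmu ?add0r; last by move=> y /psi1s[].
apply: ih => [y ys|y /psi2s[y1 /phis[z]]]; first by apply: sP; rewrite inE ys orbT.
rewrite inE => /orP[/eqP->|zs Nzy]; last by exists z.
move=> Nxy; have [|w [/= + /Nr rw1]] := y1 (p x).2; first exact: open_nbhs_nbhs.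
by rewrite rw1 subrr eqxx.
Qed.

(** Here [fsupp phi] may meet the support of [mu], so [phi] is truncated: [r] is [0] where the
    modulus of [phi] is at most [d] and [1] where it is at least [2 * d]. Then [r * phi] is
    supported away from [mu], and the remainder is bounded by [2 * d] with its support in the fixed
    compact set [fsupp phi]. *)
Lemma radon_eq0 mu phi : (forall s, measure_supp mu s -> phi s = 0) -> mu phi = 0.
Proof.
move=> phi0; apply: eq0_normc; apply/eqP; rewrite eq_le normc_ge0 andbT.
have [a a0 aP] := radon_le mu (@Cc_compact phi).
apply/ler_addgt0Pl => e e0; rewrite addr0.
have a1 : 0 < a + 1 by rewrite ltr_wpDl.
pose d := e / (a + 1) / 2.
have d0 : 0 < d by rewrite !divr_gt0.
pose r y := Num.min 1 (Num.max 0 (d^-1 * normc (phi y) - 1)).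
have cr : continuous r.
  apply: continuous_clip => y; apply: cvgB; last exact: cvg_cst.
  apply: (@cvgM R); first exact: cvg_cst.
  by apply: continuous_normc; exact: Cc_continuous.
have r01 y : 0 <= r y <= 1 by rewrite /r le_min ler01 le_max lexx ge_min lexx.
have [psi [psiE psis]] := Cc_cutoff phi cr.
have mupsi : mu psi = 0.
  apply: radon_eq0_off_supp => x /psis[rx phix] mux.
  have cl : closed [set y | d <= normc (phi y)].
    apply: (@preimage_closed _ _ (fun y => normc (phi y)) [set z | d <= z]).
      by move=> y _; apply: continuous_normc; exact: Cc_continuous.
    exact: closed_ge.
  have : [set y | d <= normc (phi y)] x.
    rewrite ((closure_id [set y | d <= normc (phi y)]).1 cl).
    apply: closureS rx => y /=.
    apply: contraNT; rewrite -ltNge => dy; rewrite /r max_l ?min_r//.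
    by rewrite subr_le0 ler_pdivrMl// mulr1 ltW.
  by rewrite /= phi0// normc0 leNgt d0.
have -> : mu phi = mu (phi - psi) by rewrite raddfB/= mupsi subr0.
have sub : fsupp (phi - psi) `<=` fsupp phi.
  apply: closureS => y; apply: contraNN => /eqP phiy; apply/eqP.
  by rewrite CcBE psiE phiy mulr0 subr0.
have ae : a * (d * 2) <= e.
  apply: (@le_trans _ _ ((a + 1) * (d * 2))); last first.
    by rewrite /d divfK// mulrC divfK// gt_eqF.
  by rewrite ler_wpM2r// ?lerDl// mulr_ge0// ltW.
apply: le_trans ae; apply: aP sub _ => x.
rewrite CcBE psiE -{1}(mul1r (phi x)) -mulrBl -rmorphB/= normcM normcR.
have [/andP[rx0 rx1]] := r01 x.
have [hx|hx] := leP (normc (phi x)) (d * 2).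
  rewrite -[leRHS]mul1r ler_pM ?normc_ge0// ger0_norm; lra.
rewrite /r max_r; last first.
  by rewrite subr_ge0 ler_pdivlMl// mulr1 (le_trans _ (ltW hx))// ler_pMr//; lra.
rewrite min_l; last by rewrite lerBrDr ler_pdivlMl// ltW.
by rewrite subrr normr0 mul0r mulr_ge0// ltW.
Qed.

End radon_vanishing.

(** * Atomic functionals and their total variation *)

Section atomic.
Variables (R : realType) (G : topologicalZmodType).
Hypotheses (G_hausdorff : hausdorff_space G)
  (G_locally_compact : locally_compact [set: G]).
Implicit Types (phi psi : Cc R G) (mu : radon_measure R G) (c d : G -> R[i])
  (D : Cc R G -> R[i]) (F : seq G) (K L U : set G).

(* D = \sum_s d s * delta_s *)
Definition atomic D d := forall phi F, uniq F ->
  (forall s, d s * phi s != 0 -> s \in F) -> D phi = \sum_(s <- F) d s * phi s.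

Definition locally_finite d := forall K, compact K ->
  exists2 F, uniq F & forall s, s \in F <-> K s /\ d s != 0.

Lemma finite_set_uniq (T : eqType) (S : set T) : finite_set S ->
  exists2 F : seq T, uniq F & forall s, s \in F <-> S s.
Proof.
move=> /finite_seqP[F ->]; exists (undup F); first exact: undup_uniq.
by move=> s; rewrite mem_undup.
Qed.

Lemma uniformly_discrete_locally_finite L d : uniformly_discrete L ->
  (forall s, d s != 0 -> L s) -> locally_finite d.
Proof.
move=> udL dL K cK; apply: finite_set_uniq.
apply: sub_finite_set (uniformly_discrete_finite udL cK).
by move=> s [Ks /dL].
Qed.

(** The coefficient at a point [s] of [L] is [mu (psi s)], where [psi s] is a bump equal to [1] at
    [s] and [0] at the other points of [L]. Subtracting the interpolation of [phi] by these bumps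
    leaves a function vanishing on [L], which [radon_eq0] annihilates. *)
Lemma radon_atomic mu L : uniformly_discrete L -> measure_supp mu `<=` L ->
  exists2 c, atomic mu c & forall s, c s != 0 -> L s.
Proof.
move=> udL muL; have [V [[oV V0] VL]] := uniformly_discrete_sep udL.
have /choice[psi psiP] : forall s, exists psi : Cc R G,
    psi s = 1 /\ forall t, L s -> L t -> psi t != 0 -> t = s.
  move=> s.
  have sV : open_nbhs s (set_translate s V).
    by split; [exact: open_set_translate|exists 0; rewrite ?addr0].
  have [r [cr r01 rV kr r1]] := bump R G_hausdorff G_locally_compact sV.
  have [psi psiE] := Cc_real cr kr.
  exists psi; split=> [|t Ls Lt]; first by rewrite psiE (nbhs_singleton r1).
  rewrite psiE (inj_eq (@complexI R)) => rt.
  have [v Vv vt] : set_translate s V t by apply: rV; exact: subset_closure.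
  by apply: VL => //; rewrite -vt addrC addKr.
pose c s := if `[< L s >] then mu (psi s) else 0.
have cL s : c s != 0 -> L s by rewrite /c; case: asboolP => //; rewrite eqxx.
exists c => // phi F uF FP.
have [E uE EP] := finite_set_uniq
  (uniformly_discrete_finite udL (@Cc_compact _ _ phi)).
have -> : mu phi = \sum_(s <- E) c s * phi s.
  apply/eqP; rewrite -subr_eq0; apply/eqP.
  have <- : mu (phi - \sum_(s <- E) phi s *: psi s) =
      mu phi - \sum_(s <- E) c s * phi s.
    rewrite raddfB/= raddf_sum/=; congr (_ - _); apply: eq_big_seq => s.
    move=> /EP[Ls _]; by rewrite linearZ/= /c asboolT// mulrC.
  apply: radon_eq0 => // t /muL Lt; rewrite CcBE Cc_sumE.
  have [phit|phit] := eqVneq (phi t) 0.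
    rewrite phit sub0r; apply/eqP; rewrite oppr_eq0; apply/eqP.
    rewrite big_seq big1// => s /EP[Ls _]; rewrite CcZE.
    have [->|/((psiP s).2 t Ls Lt) ts] := eqVneq (psi s t) 0; rewrite ?mulr0//.
    by rewrite -ts phit mul0r.
  have tE : t \in E by apply/EP; split=> //; exact: fsupp_neq0.
  rewrite (bigD1_seq t)// [X in _ - (X + _)]CcZE (psiP t).1 mulr1.
  rewrite opprD addrA subrr sub0r.
  apply/eqP; rewrite oppr_eq0; apply/eqP.
  rewrite big_seq_cond big1// => s /andP[/EP[Ls _] st]; rewrite CcZE.
  have [->|/((psiP s).2 t Ls Lt) ts] := eqVneq (psi s t) 0; rewrite ?mulr0//.
  by rewrite ts eqxx in st.
apply: eq_big_uniq => // s csphi; rewrite FP//; apply/EP.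
move: csphi; rewrite mulf_eq0 negb_or => /andP[/cL Ls phis].
by split=> //; exact: fsupp_neq0.
Qed.

Lemma locally_finite_translate t c :
  locally_finite c -> locally_finite (fun s => c (s - t)).
Proof.
move=> lc K cK.
have /lc[F uF FP] : compact ((fun s => s - t) @` K).
  by apply: compact_image => //; exact: subr_continuous.
exists [seq s + t | s <- F]; first by rewrite map_inj_uniq//; exact: addIr.
move=> s; split=> [/mapP[u /FP[[v Kv <-] cu] ->]|[Ks cs]].
  by rewrite addrK subrK.
apply/mapP; exists (s - t); last by rewrite subrK.
by apply/FP; split=> //; exists s.
Qed.

Lemma locally_finite_sub c d : locally_finite c -> locally_finite d ->
  locally_finite (fun s => c s - d s).
Proof.
move=> lc ld K cK; have [F _ FP] := lc _ cK; have [E _ EP] := ld _ cK.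
apply: finite_set_uniq; apply: (@sub_finite_set _ _ [set` F ++ E]) => [s [Ks]|].
  rewrite /= mem_cat => cds; apply/orP.
  have [c0|c0] := eqVneq (c s) 0; last by left; apply/FP.
  right; apply/EP; split=> //; apply: contraNN cds => /eqP ->.
  by rewrite c0 subrr.
exact: finite_seq.
Qed.

Lemma atomic_translate t D c : atomic D c ->
  atomic (translate_measure t D) (fun s => c (s - t)).
Proof.
move=> ac phi F uF FP; rewrite /translate_measure.
rewrite (ac _ [seq s - t | s <- F]).
- by rewrite big_map; apply: eq_bigr => s _ /=; rewrite (addrC t) subrK.
- by rewrite map_inj_uniq//; exact: addIr.
- move=> s; rewrite /= => cs; apply/mapP; exists (t + s); last by rewrite addrC addKr.
  by apply: FP; rewrite addrAC subrr add0r.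
Qed.

Lemma atomic_sub D E c d : locally_finite c -> locally_finite d ->
  atomic D c -> atomic E d -> atomic (D \- E) (fun s => c s - d s).
Proof.
move=> lc ld aD aE phi F uF FP.
have [F1 _ F1P] := lc _ (@Cc_compact _ _ phi).
have [F2 _ F2P] := ld _ (@Cc_compact _ _ phi).
(* [F] may omit points where [c] and [d] cancel. The larger list contains all atoms of both on
   [fsupp phi], so that the two sums can be treated separately. *)
pose S := undup (F1 ++ F2 ++ F).
have uS : uniq S by exact: undup_uniq.
rewrite (@eq_big_uniq _ _ _ F S)//; last first.
  by move=> s /FP sF; rewrite sF mem_undup !mem_cat sF !orbT.
under eq_bigr do rewrite mulrBl.
rewrite sumrB /=; congr (_ - _).
  apply: aD => // s; rewrite mulf_eq0 negb_or => /andP[cs phis].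
  rewrite mem_undup mem_cat; apply/orP; left; apply/F1P; split=> //.
  exact: fsupp_neq0.
apply: aE => // s; rewrite mulf_eq0 negb_or => /andP[cs phis].
rewrite mem_undup !mem_cat; apply/orP; right; apply/orP; left; apply/F2P; split=> //.
exact: fsupp_neq0.
Qed.

(** [U] is itself a competitor in the infimum over open supersets, and every admissible [psi] is
    bounded by the indicator of [U]. *)
Lemma variation_le D d U F : atomic D d -> open U -> uniq F ->
  (forall s, U s -> d s != 0 -> s \in F) ->
  (Defs.variation D U <= (\sum_(s <- F) normc (d s))%:E)%E.
Proof.
move=> aD oU uF FP.
apply: (@le_trans _ _ (variation_open D U)).
  apply: ereal_inf_lbound; exists U => //; by split.
apply: ge_ereal_sup => _ [phi phi01 <-].
apply: ge_ereal_sup => _ [psi psiphi <-].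
have psi1 s : normc (psi s) <= (\1_U s : R).
  have /andP[_ h] := phi01 s; have := le_trans (psiphi s) h.
  rewrite normrC /indic; case: (s \in U) => /=; rewrite lecE /= => /andP[]//.
rewrite lee_fin (aD _ F)//; last first.
  move=> s; rewrite mulf_eq0 negb_or => /andP[ds psis]; apply: FP => //.
  move: (psi1 s); rewrite /indic; case: (boolP (s \in U)) => [/set_mem//|_] /=.
  rewrite le_eqVlt ltNge normc_ge0 orbF => /eqP/eq0_normc/eqP.
  by rewrite (negPf psis).
rewrite (le_trans (normc_sum _ _))//; apply: ler_sum => s _.
by rewrite normcM ler_piMr ?normc_ge0// (le_trans (psi1 s)).
Qed.

(** The supremum is tested on disjoint bumps around the points of [F], each multiplied by the phase
    that turns [d s] into its modulus. The bumps are narrow enough to meet no atom outside [F]. *)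
Lemma variation_ge D d U F : locally_finite d -> atomic D d -> open U ->
  uniq F -> {in F, forall s, U s} ->
  ((\sum_(s <- F) normc (d s))%:E <= Defs.variation D U)%E.
Proof.
move=> ld aD oU uF FU.
have [N [[oN N0] [K NK [cK _]]]] := nbhs_precompact G_locally_compact 0.
have [F1 _ F1P] := ld _ (compact_add (finite_compact (finite_seq F)) cK).
(* [F1] contains every atom within [N] of [F]. The finitely many differences excluded here are
   nonzero, so [V] is a neighbourhood of [0], and bumps supported in translates of [W], with [W - W]
   inside [V], separate all these points. *)
pose V := ~` [set x | exists s t, [/\ s \in F, t \in F1 ++ F, s != t & x = t - s]].
have V0 : nbhs 0 V.
  apply: open_nbhs_nbhs; split; last first.
    by move=> [s [t [_ _ st /eqP]]]; rewrite eq_sym subr_eq0 eq_sym (negPf st).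
  apply: closed_openC; apply: compact_closed => //.
  apply: finite_compact; apply: (@sub_finite_set _ _
    [set` [seq t - s | s <- F, t <- F1 ++ F]]); last exact: finite_seq.
  move=> x [s [t [sF tF _ ->]]] /=; by apply/allpairsP; exists (s, t).
have [W [[oW W0] WV]] := nbhs0_sub V0.
have WF s t y : s \in F -> t \in F1 ++ F -> W (y - s) -> W (y - t) -> t = s.
  move=> sF tF Ws Wt; apply/eqP/negPn/negP => st.
  have : V ((y - s) - (y - t)) by exact: WV.
  rewrite opprB addrC subrKA.
  by apply; exists s, t; rewrite eq_sym.
have WdF s t : s \in F -> (W `&` N) (t - s) -> d t != 0 -> t = s.
  move=> sF [Wts Nts] dt; apply: (WF _ _ t) => //; last by rewrite subrr.
  rewrite mem_cat; apply/orP; left.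
  apply/F1P; split=> //; exists s => //; exists (t - s); first exact: NK.
  by rewrite addrC subrK.
have /choice[r rP] : forall s, exists r : G -> R, s \in F ->
    [/\ continuous r, (forall y, 0 <= r y <= 1),
        compact (closure [set y | r y != 0]), r s = 1 &
        forall y, r y != 0 -> U y /\ (W `&` N) (y - s)].
  move=> s; have [sF|_] := boolP (s \in F); last by exists (cst 0).
  have sV : open_nbhs s (U `&` set_translate s (W `&` N)).
    split; first by apply: openI => //; apply: open_set_translate; exact: openI.
    by split; [exact: FU|exists 0; rewrite ?addr0].
  have [r [cr r01 rV kr r1]] := bump R G_hausdorff G_locally_compact sV.
  exists r => _; split=> //; first exact: nbhs_singleton r1.
  move=> y ry; have [Uy] : (U `&` set_translate s (W `&` N)) y.
    by apply: rV; exact: subset_closure.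
  by rewrite set_translateE.
have /choice[g gP] : forall s, exists g : Cc R G, s \in F -> forall y, g y = (r s y)%:C.
  move=> s; have [sF|_] := boolP (s \in F); last by exists 0.
  have [cr _ kr _ _] := rP s sF.
  by have [g gE] := Cc_real cr kr; exists g.
have /choice[e eP] := fun s => normc_phase (d s).
have de s : d s * e s = (normc (d s))%:C by case: (eP s).
have e1 s : normc (e s) <= 1 by case: (eP s).
pose phi : Cc R G := \sum_(s <- F) g s.
pose psi : Cc R G := \sum_(s <- F) e s *: g s.
have phiE x : phi x = (\sum_(s <- F) r s x)%:C.
  rewrite Cc_sumE rmorph_sum/=; apply: eq_big_seq => s sF; exact: gP.
have psiE x : psi x = \sum_(s <- F) e s * (r s x)%:C.
  rewrite Cc_sumE; apply: eq_big_seq => s sF; rewrite CcZE; congr (_ * _).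
  exact: gP.
have phi01 x : 0 <= \sum_(s <- F) r s x <= (\1_U x : R).
  apply/andP; split.
    by rewrite big_seq sumr_ge0// => s /rP[_ /(_ x)/andP[]].
  have [[s sF rs]|nr] := pselect (exists2 s, s \in F & r s x != 0).
    have [_ /(_ x)/andP[_ rs1] _ _ /(_ _ rs)[Ux Wxs]] := rP _ sF.
    rewrite (bigD1_seq s)//= big_seq_cond big1 ?addr0.
      by rewrite /indic mem_set.
    move=> t /andP[tF ts]; apply/eqP/negPn/negP => rt.
    have [_ _ _ _ /(_ _ rt)[_ Wxt]] := rP _ tF.
    move/eqP: ts; apply; apply: (WF _ _ x) => //; first by rewrite mem_cat tF orbT.
      by case: Wxs.
    by case: Wxt.
  rewrite big_seq big1 ?/indic ?ler0n// => s sF; apply/eqP/negPn/negP => rs.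
  by apply: nr; exists s.
have phi01C x : 0 <= phi x <= \1_U x.
  have := phi01 x; rewrite phiE /indic => /andP[phi0 phi1]; apply/andP; split.
    by rewrite ler0c.
  by rewrite -(rmorph_nat (real_complex R)) lecR.
have psiphi x : `|psi x| <= phi x.
  rewrite psiE phiE normrC lecR (le_trans (normc_sum _ _))// !big_seq.
  apply: ler_sum => s /rP[_ /(_ x)/andP[rs0 _] _ _ _].
  by rewrite normcM normcR (ger0_norm rs0) ler_piMl.
have Dpsi : D psi = (\sum_(s <- F) normc (d s))%:C.
  rewrite (aD _ F)//.
    rewrite rmorph_sum/=; apply: eq_big_seq => s sF; rewrite psiE -de.
    rewrite (bigD1_seq s)//= big_seq_cond big1.
      by have [_ _ _ -> _] := rP s sF; rewrite addr0 mulr1.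
    move=> t /andP[tF ts]; have [->|rt] := eqVneq (r t s) 0; first by rewrite mulr0.
    have [_ _ _ _ /(_ _ rt)[_ [Wst _]]] := rP _ tF; move/eqP: ts; case.
    by apply: (WF _ _ s) => //; rewrite ?subrr// mem_cat tF orbT.
  move=> s; rewrite mulf_eq0 negb_or => /andP[ds psis].
  have [t tF rt] : exists2 t, t \in F & r t s != 0.
    apply: contrapT => nt; move/eqP: psis; apply; rewrite psiE big_seq big1// => t tF.
    have [->|rt] := eqVneq (r t s) 0; first by rewrite mulr0.
    by exfalso; apply: nt; exists t.
  have [_ _ _ _ /(_ _ rt)[_ Wst]] := rP _ tF.
  by rewrite (WdF t s).
(* The same [phi] and [psi] remain admissible for every open superset of [U], which bounds the
   infimum from below. *)
apply: le_ereal_inf_tmp => _ [U' [oU' UU'] <-].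
apply: (@le_trans _ _ (variation_Cc D phi)); last first.
  apply: ereal_sup_ubound; exists phi => // x.
  have /andP[-> /= h] := phi01C x; apply: (le_trans h).
  by rewrite /indic ler_nat; case: (boolP (x \in U)) => // /set_mem/UU'/mem_set ->.
apply: ereal_sup_ubound; exists psi => //.
by rewrite Dpsi normcR ger0_norm// sumr_ge0// => s _; exact: normc_ge0.
Qed.

End atomic.

(** * Haar measure and van Hove sequences *)

Section limsup.
Variable R : realType.
Implicit Types (u : (\bar R)^nat) (e : R).

Lemma limn_esup_lt_near u e : (limn_esup u < e%:E)%E ->
  exists2 d : R, d < e & \forall n \near \oo, (u n <= d%:E)%E.
Proof.
move=> /ereal_inf_lt[_ [V Voo <-] Ve].
have [d de Vd] : exists2 d : R, d < e & (ereal_sup (u @` V) <= d%:E)%E.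
  case: (ereal_sup (u @` V)) Ve => [d|//|_]; last first.
    by exists (e - 1); [rewrite ltrBlDr ltrDl|rewrite leNye].
  by rewrite lte_fin => de; exists d.
exists d => //; apply: filterS Voo => n Vn; apply: le_trans Vd.
by apply: ereal_sup_ubound; exists n.
Qed.

Lemma limn_esup_le_near u (l : \bar R) :
  (\forall n \near \oo, (u n <= l)%E) -> (limn_esup u <= l)%E.
Proof.
move=> ul; apply: (@le_trans _ _ (ereal_sup (u @` [set n | (u n <= l)%E]))).
  by apply: ereal_inf_lbound; exists [set n | (u n <= l)%E].
by apply: ge_ereal_sup => _ [n ? <-].
Qed.

Lemma cvge0_near u e : u @ \oo --> (0 : \bar R) -> 0 < e ->
  \forall n \near \oo, (u n <= e%:E)%E.
Proof.
move=> u0 e0.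
have h : \forall n \near \oo, (u n < e%:E)%E.
  apply: (u0 [set x | (x < e%:E)%E]).
  by apply: open_nbhs_nbhs; split; [exact: open_ereal_lt_ereal|rewrite /= lte_fin].
by apply: filterS h => n /ltW.
Qed.

End limsup.

Section borel.
Variables (R : realType) (G : topologicalZmodType).
Implicit Types (A B U : set G).

Lemma borel_open U : open U -> measurable (U : set (borel G)).
Proof. by move=> oU; exact: sub_sigma_algebra. Qed.

Lemma borel_closed U : closed U -> measurable (U : set (borel G)).
Proof.
move=> cU; rewrite -[U]setCK; apply: measurableC.
by apply: borel_open; exact: closed_openC.
Qed.

Lemma measurable_subr t :
  measurable_fun [set: borel G] (fun s : borel G => (s : G) - t : borel G).
Proof.
apply: (measurability (@open G : set (set (borel G))) erefl).
move=> _ [U oU <-]; rewrite setTI; apply: borel_open.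
by apply: open_comp oU => x _; exact: subr_continuous.
Qed.

Lemma borel_translate t (B : set (borel G)) :
  measurable B -> measurable (set_translate t B : set (borel G)).
Proof.
move=> mB; rewrite set_translateE -[X in measurable X]setTI.
exact: measurable_subr.
Qed.

Lemma borel_continuous (D : set (borel G)) (f : G -> R) :
  continuous f -> measurable_fun D (f : borel G -> R).
Proof.
move=> cf; apply: measurable_funTS; apply: (measurability _ (RGenOpens.measurableE R)).
move=> _ [_ [a [b ->] <-]]; rewrite setTI; apply: borel_open.
by apply: open_comp; [move=> x _; exact: cf|exact: interval_open].
Qed.

End borel.

Section haar.
Variables (R : realType) (G : topologicalZmodType).
Hypothesis (G_hausdorff : hausdorff_space G).
Variables (theta : {measure set (borel G) -> \bar R}) (theta_haar : haar_measure theta).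
Implicit Types (A B U W K : set G).

Lemma haar_precompact (U : set (borel G)) : measurable U -> precompact (U : set G) ->
  (theta U < +oo)%E.
Proof.
move=> mU [K UK [cK clK]]; apply: le_lt_trans (haar_compact theta_haar cK).
by apply: le_measure => //; rewrite inE//; exact: borel_closed.
Qed.

(** If [W] were null, every compact set would be covered by finitely many null translates of it, and
    inner regularity would make [theta] vanish on the whole group. *)
Lemma haar_open_gt0 W : open W -> W !=set0 -> (0 < theta W)%E.
Proof.
move=> oW [w Ww]; rewrite lt0e measure_ge0 andbT; apply/negP => /eqP W0.
have := haar_neq0 theta_haar; rewrite (haar_inner_regular theta_haar openT).
move/negP; apply; rewrite eq_le; apply/andP; split; last first.
  apply: ereal_sup_ubound; exists set0; last exact: measure0.
  by split; [exact: compact0|].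
apply: ge_ereal_sup => _ [K [cK _] <-].
have xW x : K x -> open_nbhs x (set_translate (x - w) W).
  by split; [exact: open_set_translate|exists w => //; rewrite subrK].
have [s [_ Ks]] := compact_open_cover cK xW.
apply: (@le_trans _ _ (theta (\big[setU/set0]_(x <- s) set_translate (x - w) W))).
  apply: le_measure; rewrite ?inE.
  - by apply: borel_closed; exact: compact_closed.
  - apply: bigsetU_measurable => x _.
    by apply: borel_open; exact: open_set_translate.
  - by move=> y /Ks[x xs Wy]; rewrite -bigcup_seq; exists x.
elim: s {Ks} => [|x s ih]; first by rewrite big_nil measure0.
have mT y : measurable (set_translate (y - w) W : set (borel G)).
  by apply: borel_open; exact: open_set_translate.
rewrite big_cons; set T := \big[_/_]_(y <- s) _.
apply: (@le_trans _ _ (theta (set_translate (x - w)%R W) + theta T)%E).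
  by apply: measureU2 => //; exact: bigsetU_measurable.
rewrite (haar_invariant theta_haar); last exact: borel_open.
by rewrite W0 add0e.
Qed.

Lemma integral_sum_indic (I : eqType) (s : seq I) (k : I -> R) (T : I -> set (borel G))
    (D : set (borel G)) : measurable D -> (forall i, 0 <= k i) ->
    (forall i, measurable (T i)) ->
  (\int[theta]_(x in D) (\sum_(i <- s) k i * \1_(T i) x)%:E =
   \sum_(i <- s) (k i)%:E * theta (T i `&` D))%E.
Proof.
move=> mD k0 mT.
rewrite (eq_integral (fun x => \sum_(i <- s) (k i * \1_(T i) x)%:E)%E); last first.
  by move=> x _; rewrite sumEFin.
rewrite ge0_integral_sum//.
- apply: eq_bigr => i _.
  rewrite (eq_integral (fun x => (k i)%:E * (\1_(T i) x)%:E)%E); last first.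
    by move=> x _; rewrite EFinM.
  rewrite ge0_integralZl_EFin//; first by rewrite integral_indic.
  by apply/measurable_EFinP; exact: measurable_indic.
- move=> i; apply/measurable_EFinP; apply: measurable_funM => //.
- by move=> i x _; rewrite lee_fin mulr_ge0.
Qed.

(** Translation boundedness read on coefficients: the mass of [c] in each [x - W] is at most [C].
    Quantifying over finite lists avoids infinite sums. *)
Definition window_bounded W (c : G -> R[i]) C := forall x F, uniq F ->
  (forall s, s \in F -> W (x - s)) -> \sum_(s <- F) normc (c s) <= C.

Lemma window_bounded_translate W c C t : window_bounded W c C ->
  window_bounded W (fun s => c (s - t)) C.
Proof.
move=> Wc x F uF FW.
have := Wc (x - t) [seq s - t | s <- F]; rewrite big_map; apply.
  by rewrite map_inj_uniq//; exact: addIr.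
by move=> _ /mapP[s sF ->]; rewrite opprB addrA subrK; exact: FW.
Qed.

Lemma window_bounded_sub W c d C C' : window_bounded W c C ->
  window_bounded W d C' -> window_bounded W (fun s => c s - d s) (C + C').
Proof.
move=> Wc Wd x F uF FW.
apply: le_trans (lerD (Wc x F uF FW) (Wd x F uF FW)).
rewrite -big_split/=; apply: ler_sum => s _.
by rewrite (le_trans (normc_triangle _ _))// normcN.
Qed.

(* Integrate x |-> \sum_(s in F, x in s + W) |c s| over M. *)
Lemma window_bounded_measure W c C F (M : set (borel G)) :
  open W -> window_bounded W c C -> uniq F -> measurable M ->
  (forall s x, s \in F -> W (x - s) -> M x) ->
  ((\sum_(s <- F) normc (c s))%:E * theta W <= C%:E * theta M)%E.
Proof.
move=> oW Wc uF mM FM.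
have C0 : 0 <= C by have := Wc 0 [::] isT; rewrite big_nil; apply.
have mW s : measurable (set_translate s W : set (borel G)).
  by apply: borel_open; exact: open_set_translate.
have c0 s : 0 <= normc (c s) by exact: normc_ge0.
have := integral_sum_indic F measurableT c0 mW.
under [X in _ = X -> _]eq_bigr do
  rewrite setIT (haar_invariant theta_haar _ (borel_open oW)).
rewrite -ge0_sume_distrl; last by move=> s _; rewrite lee_fin.
rewrite sumEFin => <-.
(* A one-term sum presents [C * theta M] as an integral of the same shape, so that the two
   integrands can be compared pointwise. *)
have := integral_sum_indic [:: tt] measurableT (fun=> C0) (fun=> mM).
rewrite big_seq1 setIT => <-.
apply: ge0_le_integral => //.
- move=> x _; rewrite lee_fin sumr_ge0// => s _; exact: mulr_ge0.
- apply/measurable_EFinP; apply: measurable_sum => s.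
  by apply: measurable_funM => //; exact: measurable_indic.
- apply/measurable_EFinP; apply: measurable_sum => s.
  by apply: measurable_funM => //; exact: measurable_indic.
move=> x _; rewrite lee_fin big_seq1.
have E : \sum_(s <- F) normc (c s) * \1_(set_translate s W) x =
    \sum_(s <- [seq s <- F | `[< W (x - s) >]]) normc (c s).
  rewrite big_filter [RHS]big_mkcond; apply: eq_bigr => s _.
  rewrite /indic set_translateE.
  case: asboolP => h; first by rewrite mem_set// mulr1.
  by rewrite memNset// mulr0.
rewrite [leLHS]E.
have [xM|xM] := pselect (M x).
  rewrite /indic mem_set// mulr1; apply: (Wc x); first by rewrite filter_uniq.
  by move=> s; rewrite mem_filter => /andP[/asboolP].
rewrite (_ : [seq _ <- _ | _] = [::]) ?big_nil ?mulr_ge0//.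
apply/eqP; rewrite -[_ == _]negbK -has_filter; apply/hasPn => s sF.
by apply/asboolP => Ws; apply: xM; exact: FM Ws.
Qed.

Variables (A : (set G)^nat) (A_van_hove : van_hove theta A).

Lemma van_hove_fin n : theta (A n) = (fine (theta (A n)))%:E.
Proof.
rewrite fineK// ge0_fin_numE//; apply: haar_precompact.
  by apply: borel_open; exact: van_hove_open A_van_hove n.
exact: van_hove_precompact A_van_hove n.
Qed.

Lemma van_hove_fine_gt0 n : 0 < fine (theta (A n)).
Proof. by rewrite -lte_fin -van_hove_fin; exact: van_hove_gt0 A_van_hove n. Qed.

(** If [s] is in [A n + K] and in [~A n - K], then [s + W] lies in the van Hove boundary for [K'].
    By [window_bounded_measure] the mass of such atoms is at most [C] over the measure of [W] times
    the measure of that boundary. The threshold on [n] is uniform in [F]. *)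
Lemma van_hove_boundary_small W c C K (e : R) :
  open W -> W !=set0 -> precompact W -> window_bounded W c C -> compact K -> 0 < e ->
  \forall n \near \oo, forall F, uniq F ->
    (forall s, s \in F -> set_add (A n) K s /\ set_sub (~` A n) K s) ->
  \sum_(s <- F) normc (c s) <= e * fine (theta (A n)).
Proof.
move=> oW W0 pW Wc cK e0; have [K2 WK2 [cK2 _]] := pW.
have C0 : 0 <= C by have := Wc 0 [::] isT; rewrite big_nil; apply.
pose K' := set_add K K2 `|` set_sub K K2.
have cK' : compact K' by apply: compactU; [exact: compact_add|exact: compact_sub].
have W_gt0 := haar_open_gt0 oW W0.
have W_fin : (theta W)%E = (fine (theta W))%:E.
  by rewrite fineK// ge0_fin_numE//; apply: haar_precompact => //; exact: borel_open.
rewrite W_fin lte_fin in W_gt0.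
have C1 : 0 < C + 1 by rewrite ltr_wpDl.
(* Boundary ratio for which the resulting bound is at most [e]; [C + 1] replaces [C], which may be
   [0]. *)
have eta0 : 0 < e * fine (theta W) / (C + 1) by rewrite divr_gt0// mulr_gt0.
have := cvge0_near (van_hove_cvg A_van_hove cK') eta0.
apply: filterS => n bn F uF FA.
have mb : measurable (van_hove_boundary K' (A n) : set (borel G)).
  by apply: borel_closed; apply: closedU; apply: closedI; exact: closed_closure.
have := window_bounded_measure oW Wc uF mb; rewrite W_fin.
have bnd s x : s \in F -> W (x - s) -> van_hove_boundary K' (A n) x.
  move=> /FA[[a Aa [k Kk ak]] [b Ab [k' Kk' bk]]] Wxs.
  have xAK : set_add (A n) K' x.
    exists a => //; exists (x - a); last by rewrite addrC subrK.
    left; exists k => //; exists (x - s); first exact: WK2.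
    by rewrite -ak opprD addrCA; congr (_ + _); rewrite addrC subrK.
  have xAcK : set_sub (~` A n) K' x.
    exists b => //; exists (b - x); last by rewrite subKr.
    right; exists k' => //; exists (x - s); first exact: WK2.
    by rewrite -bk opprB addrCA addrA subrK addrC.
  have [Ax|Ax] := pselect (A n x).
    by right; split; exact: subset_closure.
  by left; split; exact: subset_closure.
move=> /(_ bnd) h.
have : (theta (van_hove_boundary K' (A n)) <=
   (e * fine (theta W) / (C + 1))%:E * (fine (theta (A n)))%:E)%E.
  move: bn; rewrite van_hove_fin inver gt_eqF ?van_hove_fine_gt0//.
  by rewrite lee_pdivrMr ?van_hove_fine_gt0.
have C0' : (0 <= C%:E)%E by rewrite lee_fin.
move=> /(lee_wpmul2l C0')/(le_trans h).
rewrite -!EFinM lee_fin => h2.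
rewrite -(ler_pM2r W_gt0) (le_trans h2)//.
have An0 := van_hove_fine_gt0 n.
have -> : C * (e * fine (theta W) / (C + 1) * fine (theta (A n))) =
  (C / (C + 1)) * (e * fine (theta (A n)) * fine (theta W)) by ring.
rewrite ler_piMl ?mulr_ge0// ?ltW//.
by rewrite ltr_pdivrMr// mul1r ltrDl.
Qed.

End haar.

(** * Norm almost periods yield mean almost periodicity *)

Section convolution.
Variables (R : realType) (G : topologicalZmodType).
Hypotheses (G_hausdorff : hausdorff_space G)
  (G_locally_compact : locally_compact [set: G]).
Implicit Types (phi : Cc R G) (c d : G -> R[i]) (D : Cc R G -> R[i]) (K : set G).

Lemma Cc_bounded phi : exists2 M : R, 0 <= M & forall x, normc (phi x) <= M.
Proof.
have /compact_bounded[M [_ Mb]] : compact ((fun x => normc (phi x)) @` fsupp phi).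
  apply: continuous_compact; last exact: Cc_compact.
  by apply: continuous_subspaceT; apply: continuous_normc; exact: Cc_continuous.
exists (`|M| + 1) => [|x]; first by rewrite addr_ge0.
have [->|phix] := eqVneq (phi x) 0; first by rewrite normc0 addr_ge0.
have MM : M < `|M| + 1 by rewrite (le_lt_trans (ler_norm M))// ltrDl.
have /= := Mb _ MM (normc (phi x)); rewrite ger0_norm ?normc_ge0//; apply.
by exists x => //; exact: fsupp_neq0.
Qed.

Lemma convolution_sub (mu : Cc R G -> R[i]) phi t :
  (convolution mu phi \- translate_fun t (convolution mu phi)) =
  convolution (mu \- translate_measure t mu) phi.
Proof.
apply/funext => x; rewrite /convolution /translate_fun /translate_measure /=.
congr (mu _ - mu _); apply: CcP => s /=.
by rewrite opprD addrA.
Qed.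

Lemma convolutionE D d phi K F : atomic D d -> uniq F ->
  (forall s x, K x -> d s * phi (x - s) != 0 -> s \in F) ->
  forall x, K x -> convolution D phi x = \sum_(s <- F) d s * phi (x - s).
Proof. by move=> aD uF FP x Kx; apply: aD => // s; exact: FP. Qed.

(** The atoms in [K - fsupp phi] serve all [x] in [K] at once, so on [K] the convolution is a fixed
    finite sum of continuous functions. *)
Lemma convolution_finite D d phi K : locally_finite d -> atomic D d ->
  compact K -> exists2 F, uniq F &
    (forall s, s \in F -> d s != 0) /\
    (forall s x, K x -> d s * phi (x - s) != 0 -> s \in F).
Proof.
move=> ld aD cK; have [F uF FP] := ld _ (compact_sub cK (@Cc_compact _ _ phi)).
exists F => //; split=> [s /FP[]//|s x Kx].
rewrite mulf_eq0 negb_or => /andP[ds /fsupp_neq0 xs]; apply/FP; split=> //.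
by exists x => //; exists (x - s) => //; rewrite subKr.
Qed.

Lemma measurable_convolution D d phi (B : set (borel G)) : locally_finite d ->
  atomic D d -> measurable B -> precompact (B : set G) ->
  measurable_fun B (fun x : borel G => normc (convolution D phi x)).
Proof.
move=> ld aD mB [K BK [cK _]]; have [F uF [_ FP]] := convolution_finite phi ld aD cK.
apply: (eq_measurable_fun (fun x : borel G =>
    normc (\sum_(s <- F) d s * phi ((x : G) - s)))).
  by move=> x /set_mem/BK Kx; rewrite (convolutionE aD uF FP).
apply: borel_continuous; apply: continuous_normc.
elim: F {uF FP} => [|s F ih] x.
  by under eq_fun do rewrite big_nil; exact: cvg_cst.
under eq_fun do rewrite big_cons.
apply: cvgD; last exact: ih.
apply: (@cvgM R[i]); first exact: cvg_cst.
apply: (@continuous_comp _ _ _ (fun y : G => y - s) phi).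
  exact: subr_continuous.
exact: Cc_continuous.
Qed.

End convolution.

(** * Upper bound for the mean of a convolution *)

Section norm_almost_periods_imp.
Variables (R : realType) (G : topologicalZmodType).
Hypotheses (G_hausdorff : hausdorff_space G)
  (G_locally_compact : locally_compact [set: G]).
Variables (theta : {measure set (borel G) -> \bar R}) (theta_haar : haar_measure theta).
Variables (A : (set G)^nat) (A_van_hove : van_hove theta A).
Implicit Types (phi : Cc R G) (c d : G -> R[i]) (D : Cc R G -> R[i]).

(** The window is [-V], since [s] is in [x + V] exactly when [x - s] is in [-V]. The constant is the
    supremum of the variation over translates of [V], which bounds the sums by [variation_ge]. *)
Lemma translation_bounded_window (D : Cc R G -> R[i]) c : locally_finite c ->
  atomic D c -> translation_bounded D ->
  exists W C, [/\ open W, W !=set0, precompact W & window_bounded W c C].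
Proof.
move=> lc ac [V [oV [v Vv] [K VK [cK clK]]]].
set S := ereal_sup _ => Sy; exists (-%R @` V), (fine S); split.
- exact: open_set_opp.
- by exists (- v), v.
- exists (-%R @` K) => [_ [x Vx <-]|]; first by exists x => //; exact: VK.
  by split; [|apply: compact_closed => //]; exact: compact_opp.
move=> x F uF FV.
have S_ge : ((\sum_(s <- F) normc (c s))%:E <= S)%E.
  apply: (@le_trans _ _ (Defs.variation D (set_translate x V))); last first.
    by apply: ereal_sup_ubound; exists x.
  apply: (variation_ge G_hausdorff G_locally_compact lc ac _ uF).
    exact: open_set_translate.
  move=> s /FV[w Vw]; rewrite set_translateE /= => /eqP.
  by rewrite eqr_oppLR opprB => /eqP <-.
rewrite -lee_fin fineK// fin_real// Sy andbT.
by apply: lt_le_trans S_ge; rewrite ltNyr.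
Qed.

Lemma variation_van_hove_le D d n (e : R) F : locally_finite d -> atomic D d ->
  (Defs.variation D (A n) / theta (A n) <= e%:E)%E ->
  uniq F -> (forall s, s \in F -> A n s) ->
  \sum_(s <- F) normc (d s) <= e * fine (theta (A n)).
Proof.
move=> ld aD h uF FA.
have An0 := van_hove_fine_gt0 theta_haar A_van_hove n.
move: h; rewrite (van_hove_fin theta_haar A_van_hove n).
rewrite inver gt_eqF// lee_pdivrMr// -EFinM => h.
rewrite -lee_fin; apply: le_trans h.
apply: (variation_ge G_hausdorff G_locally_compact ld aD _ uF) => //.
exact: van_hove_open A_van_hove n.
Qed.

(** [B] is a bound of [phi] times the measure of [fsupp phi]. It is chosen before [D], so that it
    does not depend on the translation. Atoms in [A n] are accounted for by [S]; those outside [A n]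
    that reach it through [phi] lie near the boundary. *)
Lemma integral_convolution_le phi : exists2 B : R, 0 <= B &
  forall D d W C (e : R), locally_finite d -> atomic D d ->
    open W -> W !=set0 -> precompact W -> window_bounded W d C -> 0 < e ->
    \forall n \near \oo, forall S : R,
      (forall F, uniq F -> (forall s, s \in F -> A n s) ->
         \sum_(s <- F) normc (d s) <= S) ->
      (\int[theta]_(x in A n) (normc (convolution D phi x))%:E
       <= (B * (S + e * fine (theta (A n))))%:E)%E.
Proof.
have [M M0 phiM] := Cc_bounded phi.
have cK := @Cc_compact _ _ phi; set K := fsupp phi in cK.
have mK : measurable (K : set (borel G)).
  by apply: borel_closed; exact: closed_closure.
have K_fin : theta K = (fine (theta K))%:E.
  by rewrite fineK// ge0_fin_numE//; exact: haar_compact.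
have k0 : 0 <= fine (theta K) by exact: fine_ge0.
exists (M * fine (theta K)) => [|D d W C e ld aD oW W0 pW Wd e0].
  exact: mulr_ge0.
(* For an atom [s] outside [A n] with [s = a - k], the part [-K] places [s] in [A n + K1], and [0]
   places it in [~A n - K1]. *)
pose K1 := [set 0] `|` -%R @` K.
have cK1 : compact K1.
  by apply: compactU; [exact: compact_set1|exact: compact_opp].
have := van_hove_boundary_small G_hausdorff theta_haar A_van_hove oW W0 pW Wd cK1 e0.
apply: filterS => n bn S SP.
have oA := van_hove_open A_van_hove n.
have mA : measurable (A n : set (borel G)) by exact: borel_open.
have [Q AQ [cQ _]] := van_hove_precompact A_van_hove n.
have [F0 uF0 [_ F0P]] := convolution_finite phi ld aD cQ.
pose F := [seq u <- F0 | `[< set_sub (A n) K u >]].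
have uF : uniq F by rewrite filter_uniq.
have FP s x : A n x -> d s * phi (x - s) != 0 -> s \in F.
  move=> Ax dphi; rewrite mem_filter (F0P s x)// ?andbT; last exact: AQ.
  apply/asboolP; exists x => //; exists (x - s); last by rewrite subKr.
  by move: dphi; rewrite mulf_eq0 negb_or => /andP[_ /fsupp_neq0].
have mT s : measurable (set_translate s K : set (borel G)) by exact: borel_translate.
have kd s : 0 <= normc (d s) * M by rewrite mulr_ge0// normc_ge0.
apply: (@le_trans _ _ (\int[theta]_(x in A n)
    (\sum_(s <- F) (normc (d s) * M) * \1_(set_translate s K) x)%:E)%E).
  apply: ge0_le_integral => //.
  - by move=> x _; rewrite lee_fin normc_ge0.
  - apply/measurable_EFinP; apply: (measurable_convolution _ ld) => //.
    exact: van_hove_precompact A_van_hove n.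
  - apply/measurable_EFinP; apply: measurable_sum => s.
    by apply: measurable_funM => //; exact: measurable_indic.
  move=> x Ax; rewrite lee_fin (convolutionE aD uF FP)//.
  rewrite (le_trans (normc_sum _ _))//; apply: ler_sum => s _.
  rewrite normcM -mulrA ler_wpM2l ?normc_ge0//.
  rewrite /indic set_translateE.
  have [->|/fsupp_neq0 xs] := eqVneq (phi (x - s)) 0.
    by rewrite normc0 mulr_ge0.
  by rewrite mem_set// mulr1.
rewrite integral_sum_indic//.
apply: (@le_trans _ _ (\sum_(s <- F) (normc (d s) * M)%:E * (fine (theta K))%:E)%E).
  apply: lee_sum => s _; rewrite lee_wpmul2l ?lee_fin// -K_fin.
  rewrite -(haar_invariant theta_haar s mK); apply: le_measure; rewrite ?inE//.
  exact: measurableI.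
under eq_bigr do rewrite -EFinM.
rewrite sumEFin lee_fin -mulr_suml -mulr_suml -mulrA mulrC ler_wpM2l ?mulr_ge0//.
rewrite (bigID (fun s => `[< A n s >]))/= -!(big_filter F) lerD//.
  by apply: SP => [|s]; rewrite ?filter_uniq// mem_filter => /andP[/asboolP].
apply: bn => [|s]; first by rewrite filter_uniq.
rewrite !mem_filter => /andP[/asboolP nAs /andP[/asboolP[a Aa [k Kk ak]] _]]; split.
  by exists a => //; exists (- k) => //; right; exists k.
by exists s => //; exists 0; rewrite ?subr0//; left.
Qed.

Lemma relatively_denseS (P Q : set G) : P `<=` Q ->
  relatively_dense P -> relatively_dense Q.
Proof.
move=> PQ [K [cK PK]]; exists K; split=> //; apply/seteqP; split=> // x _.
have : set_add P K x by rewrite PK.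
by move=> [p Pp [k Kk <-]]; exists p; [exact: PQ|exists k].
Qed.

Lemma almost_periods_mean_almost_periodic (mu : Cc R G -> R[i]) c :
  locally_finite c -> atomic mu c -> translation_bounded mu ->
  (forall eps : R, 0 < eps -> relatively_dense (almost_periods theta A mu eps)) ->
  mean_almost_periodic theta A mu.
Proof.
move=> lc ac tb AP phi eps eps0.
have [W [C [oW W0 pW Wc]]] := translation_bounded_window lc ac tb.
have ld t := locally_finite_sub lc (locally_finite_translate t lc).
have ad t : atomic (mu \- translate_measure t mu) (fun s => c s - c (s - t)).
  apply: atomic_sub => //; first exact: locally_finite_translate.
  exact: atomic_translate.
have Wd t := window_bounded_sub Wc (@window_bounded_translate _ _ _ _ _ t Wc).
have [B B0 BP] := integral_convolution_le phi.
have B1 : 0 < B + 1 by rewrite ltr_wpDl.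
(* One [e] pays for the almost period and one for the boundary, so that [B * (e + e) <= eps / 2].
   The halving restores the strict inequality after passing to the limsup. *)
pose e := eps / (B + 1) / 4.
have e0 : 0 < e by rewrite !divr_gt0.
apply: relatively_denseS (AP e e0) => t; rewrite /almost_periods /= => te.
have [d de dP] := limn_esup_lt_near te.
apply: (@le_lt_trans _ _ (B * (e + e))%:E); last first.
  rewrite lte_fin; apply: (@le_lt_trans _ _ ((B + 1) * (e + e))).
    by rewrite ler_wpM2r ?lerDl// addr_ge0// ltW.
  have -> : (B + 1) * (e + e) = eps / 2 by rewrite /e; field; rewrite gt_eqF.
  by rewrite ltr_pdivrMr// ltr_pMr// ltr1n.
apply: limn_esup_le_near.
have := BP _ _ _ _ e (ld t) (ad t) oW W0 pW (Wd t) e0.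
apply: filterS2 dP => n dn /(_ (d * fine (theta (A n)))) bn.
have An0 := van_hove_fine_gt0 theta_haar A_van_hove n.
rewrite (van_hove_fin theta_haar A_van_hove n) inver gt_eqF// lee_pdivrMr//.
rewrite -EFinM convolution_sub; apply: le_trans (bn _) _.
  by move=> F uF FA; apply: variation_van_hove_le FA => //.
rewrite lee_fin -mulrDl mulrA ler_wpM2r ?(ltW An0)// ler_wpM2l//.
by rewrite lerD2r ltW.
Qed.

End norm_almost_periods_imp.

(** * Mean almost periodicity yields norm almost periods *)

Section integral_lower_bound.
Variables (R : realType) (G : topologicalZmodType).
Variables (theta : {measure set (borel G) -> \bar R}) (theta_haar : haar_measure theta).
Implicit Types (r : G -> R) (u w : G).

(** Invariance of [theta] says that its pushforward under subtraction of [u] is [theta] again. *)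
Lemma haar_integral_translate r u : continuous r -> (forall x, 0 <= r x) ->
  (\int[theta]_x (r (x - u))%:E = \int[theta]_x (r x)%:E)%E.
Proof.
move=> cr r0.
have mr : measurable_fun [set: borel G] (fun x : borel G => (r x)%:E).
  by apply/measurable_EFinP; exact: borel_continuous.
have ms := @measurable_subr G u.
have := @ge0_integral_pushforward _ _ _ _ R _ ms theta setT _ measurableT mr.
rewrite preimage_setT => <-; last by move=> x _; rewrite lee_fin.
apply: eq_measure_integral => B mB _.
by rewrite -[RHS](haar_invariant theta_haar u mB) set_translateE.
Qed.

Lemma haar_integral_translate_in r u (D : set (borel G)) : continuous r ->
  (forall x, 0 <= r x) -> measurable D -> (forall x, r (x - u) != 0 -> D x) ->
  (\int[theta]_(x in D) (r ((x : G) - u))%:E = \int[theta]_x (r x)%:E)%E.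
Proof.
move=> cr r0 mD rD; rewrite -(haar_integral_translate u cr r0).
rewrite integral_mkcond; apply: eq_integral => x _.
rewrite patchE; case: ifPn => // /negP xD; congr (_%:E).
apply/eqP; rewrite eq_sym; apply/negPn/negP => rx.
by apply: xD; apply: mem_set; exact: rD.
Qed.

(* |a r(x-u) - b r(x-w)| >= Re (z (a r(x-u) - b r(x-w))) for the phase z of
   a - b; moving the integrals of r to the left-hand side with nonnegative
   coefficients avoids integrability conditions. *)
Lemma integral_sub_translates r u w (a b : R[i]) (k : R) (D : set (borel G)) :
  continuous r -> (forall x, 0 <= r x) -> measurable D ->
  (forall x, r (x - u) != 0 -> D x) -> (forall x, r (x - w) != 0 -> D x) ->
  (\int[theta]_x (r x)%:E = k%:E)%E ->
  ((normc (a - b) * k)%:E <= \int[theta]_(x in D)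
     (normc (a * (r ((x : G) - u))%:C - b * (r ((x : G) - w))%:C))%:E)%E.
Proof.
move=> cr r0 mD rDu rDw rk.
have [z [z1 zab]] := normc_phase (a - b).
pose al := complex.Re (a * z); pose be := complex.Re (b * z).
have albe : al - be = normc (a - b).
  by rewrite /al /be -raddfB -mulrBl zab.
have cu v : continuous (fun x => r (x - v)).
  move=> x; apply: (@continuous_comp _ _ _ (fun y : G => y - v) r).
    exact: subr_continuous.
  exact: cr.
have mr v : measurable_fun D (fun x : borel G => (r ((x : G) - v))%:E).
  by apply/measurable_EFinP; exact: (@borel_continuous _ _ D _ (cu v)).
have Iu : (\int[theta]_(x in D) (r ((x : G) - u))%:E = k%:E)%E.
  by rewrite (haar_integral_translate_in cr r0 mD rDu).
have Iw : (\int[theta]_(x in D) (r ((x : G) - w))%:E = k%:E)%E.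
  by rewrite (haar_integral_translate_in cr r0 mD rDw).
pose h x := normc (a * (r (x - u))%:C - b * (r (x - w))%:C).
have ch : continuous h.
  apply: continuous_normc => x; apply: cvgB.
    apply: (@cvgM R[i]); first exact: cvg_cst.
    exact: (continuous_complexR (cu u)).
  apply: (@cvgM R[i]); first exact: cvg_cst.
  exact: (continuous_complexR (cu w)).
have mh : measurable_fun D (fun x : borel G => (h x)%:E).
  by apply/measurable_EFinP; exact: (@borel_continuous _ _ D _ ch).
have lin (p q : R) : 0 <= p -> 0 <= q ->
    (\int[theta]_(x in D) (p%:E * (r ((x : G) - u))%:E + q%:E * (r ((x : G) - w))%:E)
     = ((p + q) * k)%:E)%E.
  move=> p0 q0; rewrite ge0_integralD//.
  - rewrite !ge0_integralZl_EFin//; try by move=> x _; rewrite lee_fin.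
    by rewrite Iu Iw -!EFinM -EFinD mulrDl.
  - by move=> x _; rewrite -EFinM lee_fin mulr_ge0.
  - exact: measurable_funeM.
  - by move=> x _; rewrite -EFinM lee_fin mulr_ge0.
  - exact: measurable_funeM.
have L := lin (al + `|al|) (`|be| - be).
have Rr := lin `|al| `|be| (normr_ge0 _) (normr_ge0 _).
have pt x : (al + `|al|) * r (x - u) + (`|be| - be) * r (x - w) <=
    h x + (`|al| * r (x - u) + `|be| * r (x - w)).
  rewrite mulrDl mulrBl.
  suff : al * r (x - u) - be * r (x - w) <= h x by lra.
  have -> : al * r (x - u) - be * r (x - w) =
      complex.Re ((a * (r (x - u))%:C - b * (r (x - w))%:C) * z).
    rewrite mulrBl raddfB/= /al /be !(mulrAC _ _ z).
    by case: (a * z) => a1 a2; case: (b * z) => b1 b2 /=; rewrite !mulr0 !subr0.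
  rewrite (le_trans (ler_Re_normc _))// normcM /h.
  by rewrite ler_piMr// normc_ge0.
have al0 : 0 <= al + `|al| by have := ler_norm (- al); rewrite normrN; lra.
have be0 : 0 <= `|be| - be by rewrite subr_ge0 ler_norm.
have : (((al + `|al| + (`|be| - be)) * k)%:E <=
   \int[theta]_(x in D) (h x)%:E + ((`|al| + `|be|) * k)%:E)%E.
  have mg p q : measurable_fun D (fun x : borel G =>
      p%:E * (r ((x : G) - u))%:E + q%:E * (r ((x : G) - w))%:E)%E.
    by apply: emeasurable_funD; exact: measurable_funeM.
  have g0 (p q : R) (x : G) : 0 <= p -> 0 <= q ->
      (0 <= p%:E * (r (x - u))%:E + q%:E * (r (x - w))%:E)%E.
    by move=> p0 q0; rewrite -!EFinM -EFinD lee_fin addr_ge0// mulr_ge0.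
  have h0 x : (0 <= (h x)%:E)%E by rewrite lee_fin normc_ge0.
  rewrite -L// -Rr -ge0_integralD//; last by move=> x _; exact: g0.
  apply: ge0_le_integral => //; first by move=> x _; exact: g0.
    exact: emeasurable_funD.
  by move=> x _; rewrite -!EFinM -!EFinD lee_fin.
rewrite -leeBlDr// -EFinB; apply: le_trans; rewrite lee_fin -albe.
by rewrite le_eqVlt; apply/orP; left; apply/eqP; ring.
Qed.

End integral_lower_bound.

(** * Offset correction and lower bound for the mean of a convolution *)

Section mean_almost_periodic_imp.
Variables (R : realType) (G : topologicalZmodType).
Hypotheses (G_hausdorff : hausdorff_space G)
  (G_locally_compact : locally_compact [set: G]).
Variables (theta : {measure set (borel G) -> \bar R}) (theta_haar : haar_measure theta).
Variables (A : (set G)^nat) (A_van_hove : van_hove theta A).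
Variables (mu : Cc R G -> R[i]) (c : G -> R[i]) (Lambda : set G).
Hypotheses (ac : atomic mu c) (c_Lambda : forall s, c s != 0 -> Lambda s)
  (Lambda_ud : uniformly_discrete Lambda)
  (Lambda_sub_ud : uniformly_discrete (set_sub Lambda Lambda)).

Let lc : locally_finite c.
Proof. exact: uniformly_discrete_locally_finite Lambda_ud c_Lambda. Qed.

(** [U0] is chosen with [U0 - U0] inside [V1] and [U1], and [U1 - U1] inside [V2]. Hence differences
    from [Q] separate [Lambda], and differences of such differences separate [Lambda - Lambda]. The
    integral is positive because [r = 1] near [0], and finite because [r] is at most the indicator
    of [Q]. *)
Lemma small_bump : exists (r : G -> R) (phi : Cc R G) (Q : set G),
  [/\ [/\ continuous r, (forall x, 0 <= r x), (forall x, phi x = (r x)%:C),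
        compact Q & (forall x, r x != 0 -> Q x)],
    Q 0,
    (forall s t, Lambda s -> Lambda t -> set_sub Q Q (s - t) -> s = t),
    (forall p q t, set_sub Lambda Lambda p -> set_sub Lambda Lambda q ->
      set_sub Q Q (p - t) -> set_sub Q Q (q - t) -> p = q) &
    exists2 k : R, 0 < k & (\int[theta]_x (r x)%:E = k%:E)%E].
Proof.
have [V1 [[oV1 V10] V1L]] := uniformly_discrete_sep Lambda_ud.
have [V2 [V20 V2L]] := uniformly_discrete_sep Lambda_sub_ud.
have [U1 [[oU1 U10] U1V]] := nbhs0_sub (open_nbhs_nbhs V20).
have V1U1 : nbhs 0 (V1 `&` U1).
  by apply: open_nbhs_nbhs; split=> //; exact: openI.
have [U0 [oU0 U0V]] := nbhs0_sub V1U1.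
have [r [cr r01 rU kr r1]] := bump R G_hausdorff G_locally_compact oU0.
have [phi phiE] := Cc_real cr kr.
set Q := closure _ in rU kr.
have rQ x : r x != 0 -> Q x by move=> rx; exact: subset_closure.
have r0 x : 0 <= r x by case/andP: (r01 x).
have r_1 : r 0 = 1 := nbhs_singleton r1.
exists r, phi, Q; split.
- by split.
- by apply: rQ; rewrite r_1 oner_neq0.
- move=> s t Ls Lt [x Qx [y Qy xy]]; apply: V1L => //; rewrite -xy.
  by case: (U0V x y); [exact: rU|exact: rU|].
- move=> p q t Lp Lq [x Qx [y Qy xy]] [x' Qx' [y' Qy' xy']]; apply: V2L => //.
  have -> : p - q = (x - y) - (x' - y').
    by rewrite xy xy' opprB addrA subrK.
  by apply: U1V; [case: (U0V x y)|case: (U0V x' y')]; try exact: rU.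
have mr : measurable_fun [set: borel G] (fun x : borel G => (r x)%:E).
  by apply/measurable_EFinP; exact: borel_continuous.
have mQ : measurable (Q : set (borel G)) by apply: borel_closed; exact: closed_closure.
have lt_y : (\int[theta]_x (r x)%:E < +oo)%E.
  apply: le_lt_trans (haar_compact theta_haar kr).
  have -> : theta Q = (\int[theta]_x (\1_(Q : set (borel G)) x)%:E)%E.
    by rewrite integral_indic ?setIT.
  apply: ge0_le_integral => //; first by move=> x _; rewrite lee_fin.
    by apply/measurable_EFinP; exact: measurable_indic.
  move=> x _; rewrite lee_fin.
  have [->|/rQ Qx] := eqVneq (r x) 0; first by rewrite /indic ler0n.
  by rewrite /indic mem_set//; case/andP: (r01 x).
have gt_0 : (0 < \int[theta]_x (r x)%:E)%E.
  move: r1; rewrite /prop_near1 nbhsE => -[N [oN N0] Nr].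
  apply: (@lt_le_trans _ _ (theta N)).
    by apply: (haar_open_gt0 G_hausdorff theta_haar oN); exists 0.
  have mN : measurable (N : set (borel G)) by exact: borel_open.
  have -> : theta N = (\int[theta]_x (\1_(N : set (borel G)) x)%:E)%E.
    by rewrite integral_indic ?setIT.
  apply: ge0_le_integral => //.
    by apply/measurable_EFinP; exact: measurable_indic.
  move=> x _; rewrite lee_fin /indic.
  by have [/set_mem/Nr ->|] := boolP (x \in N).
exists (fine (\int[theta]_x (r x)%:E)%E).
  by rewrite -lte_fin fineK// ge0_fin_numE// ltW.
by rewrite fineK// ge0_fin_numE// ltW.
Qed.

Variables (r : G -> R) (phi : Cc R G) (Q : set G).
Hypotheses (cr : continuous r) (r0 : forall x, 0 <= r x)
  (phiE : forall x, phi x = (r x)%:C) (cQ : compact Q)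
  (rQ : forall x, r x != 0 -> Q x) (Q0 : Q 0)
  (Q_sep : forall s t, Lambda s -> Lambda t -> set_sub Q Q (s - t) -> s = t)
  (QQ_sep : forall p q t, set_sub Lambda Lambda p -> set_sub Lambda Lambda q ->
      set_sub Q Q (p - t) -> set_sub Q Q (q - t) -> p = q).

(* Any two points of the support and of its t-translate that are Q-close differ
   by the same v, so that after correcting t by v they coincide. *)
Lemma common_offset t : exists2 v, set_sub Q Q v &
  forall s s', c s != 0 -> c s' != 0 -> set_sub Q Q (s - s' - t) ->
    s - s' - t = v.
Proof.
have [[s [s' [cs cs' Qss]]]|nex] := pselect (exists s s',
    [/\ c s != 0, c s' != 0 & set_sub Q Q (s - s' - t)]); last first.
  (* Without a close pair the condition is vacuous, and [0] is in [Q - Q]. *)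
  exists 0; first by exists 0 => //; exists 0; rewrite ?subr0.
  by move=> s s' cs cs' Qss; exfalso; apply: nex; exists s, s'.
have LL x y : c x != 0 -> c y != 0 -> set_sub Lambda Lambda (x - y).
  by move=> /c_Lambda Lx /c_Lambda Ly; exists x => //; exists y.
exists (s - s' - t) => // u u' cu cu' Quu; congr (_ - t).
by apply: (QQ_sep (t := t)) => //; exact: LL.
Qed.

Variables (t v : G).
Hypothesis t_v : forall s s', c s != 0 -> c s' != 0 ->
  set_sub Q Q (s - s' - t) -> s - s' - t = v.

(** The atom of [translate_measure t mu] at [u - v] has coefficient [c (u - (t + v))]. It is paired
    with the atom of [mu] at [u], where translation by [t + v] would have put it. *)
Let g u x : R[i] := c u * (r (x - u))%:C - c (u - (t + v)) * (r (x - (u - v)))%:C.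

Let active u x : bool :=
  (c u * (r (x - u))%:C != 0) || (c (u - (t + v)) * (r (x - (u - v)))%:C != 0).

(** Disjointness of the supports. Two bumps of the same measure at [x] have the same centre by
    [Q_sep]. For bumps of different measures, [t_v] forces the offset [v], so they belong to the
    same pair. *)
Let active_inj u w x : active u x -> active w x -> u = w.
Proof.
have nz (a : R[i]) y : a * (r y)%:C != 0 -> a != 0 /\ Q y.
  rewrite mulf_eq0 negb_or (inj_eq (@complexI R)) => /andP[a0 /rQ Qy].
  by split.
have key u1 u2 : c u1 != 0 -> Q (x - u1) -> c (u2 - (t + v)) != 0 ->
    Q (x - (u2 - v)) -> u1 = u2.
  move=> c1 Q1 c2 Q2.
  have E : u1 - (u2 - (t + v)) - t = u1 - u2 + v.
    by rewrite opprB addrAC addrA addrA subrK addrAC.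
  have := t_v c1 c2; rewrite E => /(_ _)/eqP; rewrite -subr_eq0 addrK subr_eq0 => h.
  apply/eqP/h; exists (x - (u2 - v)) => //; exists (x - u1) => //.
  by rewrite !opprB addrC addrA subrK addrA addrAC.
move=> /orP[] /nz[cu Qu] /orP[] /nz[cw Qw].
- apply: Q_sep; [exact: c_Lambda|exact: c_Lambda|].
  exists (x - w) => //; exists (x - u) => //.
  by rewrite opprB addrC addrA subrK.
- exact: key.
- by apply/esym; exact: key.
- apply: (@addIr _ (- (t + v))); apply: Q_sep; [exact: c_Lambda|exact: c_Lambda|].
  exists (x - (w - v)) => //; exists (x - (u - v)) => //.
  have BB (a b d : G) : a - d - (b - d) = a - b by rewrite opprB addrA subrK.
  by rewrite BB [- (x - (u - v))]opprB addrC addrA subrK BB.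
Qed.

Let D := mu \- translate_measure t mu.

(** At most one index is active at [x], and when one is, the whole convolution equals its [g u x].
    The inequality allows [F] to miss that index. *)
Lemma sum_active_le F x : uniq F ->
  \sum_(u <- F) normc (g u x) <= normc (convolution D phi x).
Proof.
move=> uF; have gE u : g u x != 0 -> active u x.
  rewrite /g /active; apply: contraR; rewrite negb_or !negbK => /andP[/eqP -> /eqP ->].
  by rewrite subrr.
have [[u uF' gu]|nu] := pselect (exists2 u, u \in F & g u x != 0); last first.
  rewrite big_seq big1 ?normc_ge0// => u uF'.
  have [->|gu] := eqVneq (g u x) 0; first by rewrite normc0.
  by exfalso; apply: nu; exists u.
have au := gE _ gu.
rewrite (bigD1_seq u)//= big1 ?addr0; last first.
  move=> w wu; have [->|/gE aw] := eqVneq (g w x) 0; first by rewrite normc0.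
  by rewrite (active_inj aw au) eqxx in wu.
have -> : convolution D phi x = g u x; last by [].
rewrite -convolution_sub /convolution /translate_fun /=.
rewrite (ac (F := [:: u]))//; last first.
  move=> s; rewrite /= phiE => cs; rewrite inE; apply/eqP; apply: active_inj au.
  by rewrite /active cs.
rewrite (ac (F := [:: u - (t + v)]))//; last first.
  move=> s; rewrite /= phiE => cs; rewrite inE -[s](addrK (t + v)); apply/eqP.
  congr (_ - _); apply: active_inj au; rewrite /active addrK.
  apply/orP; right; suff -> : x - (s + (t + v) - v) = x - t - s by [].
  by rewrite addrA addrK opprD addrA addrAC.
rewrite !big_seq1 /= !phiE /g; congr (_ - _ * (r _)%:C).
by rewrite !opprB addrA addrA subrK -addrA.
Qed.

Let d u := c u - c (u - (t + v)).

(** Integrates [sum_active_le] over [A n]. Since both bumps of each pair lie inside [A n],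
    [integral_sub_translates] bounds each term from below. *)
Lemma sum_interior_le (k : R) n F : (\int[theta]_x (r x)%:E = k%:E)%E -> uniq F ->
  (forall u x, u \in F -> Q (x - u) \/ Q (x - (u - v)) -> A n x) ->
  ((\sum_(u <- F) normc (d u) * k)%:E <=
   \int[theta]_(x in A n) (normc (convolution D phi x))%:E)%E.
Proof.
move=> rk uF FA.
have oA := van_hove_open A_van_hove n.
have mA : measurable (A n : set (borel G)) by exact: borel_open.
have ctr w : continuous (fun x => r (x - w)).
  move=> x; apply: (@continuous_comp _ _ _ (fun y : G => y - w) r).
    exact: subr_continuous.
  exact: cr.
have mg u : measurable_fun (A n : set (borel G))
    (fun x : borel G => (normc (g u x))%:E).
  apply/measurable_EFinP.
  apply: (@borel_continuous _ _ (A n) (fun x => normc (g u x))).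
  apply: continuous_normc => x; apply: cvgB.
    apply: (@cvgM R[i]); first exact: cvg_cst.
    exact: (continuous_complexR (ctr _)).
  apply: (@cvgM R[i]); first exact: cvg_cst.
  exact: (continuous_complexR (ctr _)).
have ld : locally_finite (fun s => c s - c (s - t)).
  by apply: locally_finite_sub => //; exact: locally_finite_translate.
have aD : atomic D (fun s => c s - c (s - t)).
  apply: atomic_sub => //; first exact: locally_finite_translate.
  exact: atomic_translate.
apply: (@le_trans _ _ (\int[theta]_(x in A n) (\sum_(u <- F) normc (g u x))%:E)%E).
  rewrite (eq_integral (fun x : borel G => \sum_(u <- F) (normc (g u x))%:E)%E);
    last by move=> x _; rewrite sumEFin.
  rewrite ge0_integral_sum//; last by move=> u x _; rewrite lee_fin normc_ge0.
  rewrite -sumEFin big_seq [leRHS]big_seq; apply: lee_sum => u uF'.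
  apply: (integral_sub_translates theta_haar) => // x rx.
    by apply: (FA u) => //; left; exact: rQ.
  by apply: (FA u) => //; right; exact: rQ.
apply: ge0_le_integral => //.
- by move=> x _; rewrite lee_fin sumr_ge0// => u _; exact: normc_ge0.
- apply/measurable_EFinP; apply: measurable_sum => u.
  by apply/measurable_EFinP; exact: mg.
- apply/measurable_EFinP; apply: (measurable_convolution _ ld) => //.
  exact: van_hove_precompact A_van_hove n.
- by move=> x _; rewrite lee_fin; exact: sum_active_le.
Qed.

Lemma sum_offset_le (k : R) W C (e : R) :
  (\int[theta]_x (r x)%:E = k%:E)%E -> 0 < k -> open W -> W !=set0 ->
  precompact W -> window_bounded W c C -> 0 < e ->
  \forall n \near \oo, forall J : R,
    (\int[theta]_(x in A n) (normc (convolution D phi x))%:E <= J%:E)%E ->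
    forall F, uniq F -> (forall s, s \in F -> A n s) ->
    \sum_(s <- F) normc (d s) <= J / k + e * fine (theta (A n)).
Proof.
move=> rk k0 oW W0 pW Wc e0.
have Wd := window_bounded_sub Wc (@window_bounded_translate _ _ _ _ _ (t + v) Wc).
(* [0] keeps the points of [F] in [A n + K]. If a bump of the pair leaves [A n] at [x], then [u] is
   in [x - Q] or in [x - (Q - v)], according to whether its centre is [u] or [u - v]. *)
pose K := [set 0] `|` (Q `|` set_sub Q [set v]).
have cK : compact K.
  apply: compactU; first exact: compact_set1.
  by apply: compactU => //; apply: compact_sub => //; exact: compact_set1.
have := van_hove_boundary_small G_hausdorff theta_haar A_van_hove oW W0 pW Wd cK e0.
apply: filterS => n bn J IJ F uF FA.
pose int u := `[< forall x, Q (x - u) \/ Q (x - (u - v)) -> A n x >].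
rewrite (bigID int)/= -!(big_filter F) lerD//.
  rewrite ler_pdivlMr// mulr_suml -lee_fin; apply: le_trans IJ.
  apply: sum_interior_le => // [|u x]; first by rewrite filter_uniq.
  by rewrite mem_filter => /andP[/asboolP uA _]; exact: uA.
apply: bn => [|s]; first by rewrite filter_uniq.
rewrite mem_filter => /andP[/asboolP ns sF]; split.
  by exists s; [exact: FA|exists 0; rewrite ?addr0//; left].
have /existsNP[x /not_implyP[Qx nAx]] := ns.
case: Qx => Qx.
  by exists x => //; exists (x - s); [right; left|rewrite subKr].
exists x => //; exists (x - (s - v) - v); last first.
  by rewrite [- (s - v)]opprB addrA addrAC addrK subKr.
by right; right; exists (x - (s - v)) => //; exists v.
Qed.

End mean_almost_periodic_imp.

Lemma mean_almost_periodic_almost_periods (R : realType) (G : topologicalZmodType)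
    (theta : {measure set (borel G) -> \bar R}) (A : (set G)^nat)
    (mu : Cc R G -> R[i]) (c : G -> R[i]) (Lambda : set G) (eps : R) :
  hausdorff_space G -> locally_compact [set: G] ->
  haar_measure theta -> van_hove theta A ->
  atomic mu c -> (forall s, c s != 0 -> Lambda s) ->
  uniformly_discrete Lambda -> uniformly_discrete (set_sub Lambda Lambda) ->
  translation_bounded mu -> mean_almost_periodic theta A mu -> 0 < eps ->
  relatively_dense (almost_periods theta A mu eps).
Proof.
move=> hG lG haar vH ac cL ud udd tb map eps0.
have lc := uniformly_discrete_locally_finite ud cL.
have [W [C [oW W0 pW Wc]]] := translation_bounded_window hG lG lc ac tb.
have [r [phi [Q [[cr r0 phiE cQ rQ] Q0 Q_sep QQ_sep [k k0 rk]]]]] :=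
  small_bump hG lG haar ud udd.
(* Division by the integral [k] in [sum_offset_le] turns this into [eps / 4]; the boundary costs
   another [eps / 4]. *)
have e0 : 0 < k * eps / 4 by rewrite divr_gt0// mulr_gt0.
have [K [cK PK]] := map phi _ e0.
(* A point [t + y] with [y] in [K] is rewritten as [(t + v) + (y - v)], and [v] ranges over the
   compact set [Q - Q] whatever [t] is. *)
exists (set_sub K (set_sub Q Q)); split.
  by apply: compact_sub => //; exact: compact_sub.
apply/seteqP; split=> // z; rewrite -{1}PK => -[t /= te [y Ky <-]].
have [v Qv t_v] := common_offset cL Q0 QQ_sep t.
exists (t + v); last first.
  by exists (y - v); [exists y => //; exists v|rewrite addrACA subrr addr0].
rewrite /almost_periods /=.
have [d de dP] := limn_esup_lt_near te.
apply: (@le_lt_trans _ _ (eps / 2)%:E); last first.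
  by rewrite lte_fin ltr_pdivrMr// ltr_pMr// ltr1n.
apply: limn_esup_le_near.
have eps4 : 0 < eps / 4 by rewrite divr_gt0.
have := sum_offset_le hG haar vH ac cL ud cr r0 phiE cQ rQ Q_sep t_v rk k0
  oW W0 pW Wc eps4.
apply: filterS2 dP => n dn bn.
have An0 := van_hove_fine_gt0 haar vH n.
have thA := van_hove_fin haar vH n.
have [E AE [cE _]] := van_hove_precompact vH n.
have ld' : locally_finite (fun s => c s - c (s - (t + v))).
  by apply: locally_finite_sub => //; exact: locally_finite_translate.
have aD' : atomic (mu \- translate_measure (t + v) mu)
    (fun s => c s - c (s - (t + v))).
  apply: atomic_sub => //; first exact: locally_finite_translate.
  exact: atomic_translate.
(* Only finitely many atoms lie in the precompact set [A n], so its variation is bounded by one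
   finite sum, to which [sum_offset_le] applies. *)
have [F0 uF0 F0P] := ld' _ cE.
pose F := [seq s <- F0 | `[< A n s >]].
have uF : uniq F by rewrite filter_uniq.
rewrite thA inver gt_eqF// lee_pdivrMr//.
apply: le_trans (variation_le aD' (van_hove_open vH n) uF _) _.
  by move=> s As ds; rewrite mem_filter asboolT//=; apply/F0P; split=> //; exact: AE.
rewrite -EFinM lee_fin.
apply: le_trans (bn (d * fine (theta (A n))) _ F uF _) _.
- move: dn; rewrite thA inver gt_eqF// lee_pdivrMr// -EFinM.
  by rewrite convolution_sub.
- by move=> s; rewrite mem_filter => /andP[/asboolP].
rewrite mulrAC -mulrDl ler_wpM2r ?(ltW An0)//.
have : d / k <= eps / 4 by rewrite ler_pdivrMr// [leRHS]mulrAC [eps * k]mulrC ltW.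
lra.
Qed.

Theorem theorem3p22 (R : realType) (G : topologicalZmodType)
  (G_hausdorff : hausdorff_space G)
  (G_locally_compact : locally_compact [set: G])
  (G_sigma_compact : sigma_compact G)
  (theta : {measure set (borel G) -> \bar R}) (theta_haar : haar_measure theta)
  (A : (set G)^nat) (A_van_hove : van_hove theta A)
  (mu : radon_measure R G) (mu_bounded : translation_bounded mu)
  (Lambda : set G) (Lambda_ud : uniformly_discrete Lambda)
  (mu_supp : measure_supp mu `<=` Lambda) :
  ((forall eps : R, 0 < eps -> relatively_dense (almost_periods theta A mu eps)) ->
     mean_almost_periodic theta A mu) /\
  (mean_almost_periodic theta A mu ->
     uniformly_discrete (set_sub Lambda Lambda) ->
     forall eps : R, 0 < eps -> relatively_dense (almost_periods theta A mu eps)).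
Proof.
have [c ac cL] := radon_atomic G_hausdorff G_locally_compact Lambda_ud mu_supp.
have lc := uniformly_discrete_locally_finite Lambda_ud cL.
split=> [AP|map udd eps eps0].
  exact: (almost_periods_mean_almost_periodic G_hausdorff G_locally_compact
    theta_haar A_van_hove lc ac).
exact: (mean_almost_periodic_almost_periods G_hausdorff G_locally_compact
  theta_haar A_van_hove ac cL Lambda_ud udd).
Qed.
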